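(* Let $\xi_0,\xi_1,\ldots$ be i.i.d. nondegenerate real-valued random variables such that $\bar F(t):=\mathbb{P}[\log|\xi_0|>t]$ is slowly varying at $+\infty$, the limit $c:=\lim_{t\to+\infty}\mathbb{P}[\xi_0>t]/\mathbb{P}[|\xi_0|>t]\in[0,1]$ exists, and $\xi_0\ne0$ a.s. Write $p=\mathbb{P}[\xi_0>0]$, and let $N_n$ be the number of real roots (counted with multiplicities) of $G_n(z)=\sum_{k=0}^n\xi_kz^k$. Then, as $n\to\infty$, the sequence $\{N_{2n}\}_{n\in\mathbb{N}}$ converges weakly (in distribution) to a random variable $N^+_{0,c,p}$ and the sequence $\{N_{2n+1}\}_{n\in\mathbb{N}}$ converges weakly to a random variable $N^-_{0,c,p}$ such that $$\mathbb{P}[N^+_{0,c,p}=m]=\begin{cases}\frac12\bigl(cp^2+(1-c)(1-p)^2\bigr),&m=0,\\ \frac12+p(1-p),&m=2,\\ \frac12\bigl(c(1-p)^2+(1-c)p^2\bigr),&m=4,\end{cases}$$ $$\mathbb{P}[N^-_{0,c,p}=m]=\begin{cases}1-p-c+2pc,&m=1,\\ p+c-2pc,&m=3.\end{cases}$$ *)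

(* Defs.v *)
From HB Require Import structures.
From mathcomp Require Import all_boot all_order all_algebra finmap.
From mathcomp Require Import all_classical all_reals all_analysis.

Set Implicit Arguments.
Unset Strict Implicit.
Unset Printing Implicit Defensive.

Import Order.TTheory GRing.Theory Num.Theory.
Import numFieldNormedType.Exports.

Local Open Scope classical_set_scope.
Local Open Scope ring_scope.

Definition mutually_independent (d : measure_display) (T : measurableType d)
    (R : realType) (P : probability T R) (I : choiceType)
    (X : I -> {RV P >-> R}) : Prop :=
  forall (J : {fset I}) (A : I -> set R), (forall i, measurable (A i)) ->
    P (\bigcap_(i in [set` J]) (X i @^-1` A i)) =
    (\prod_(i <- J) P (X i @^-1` A i))%E.

Definition identically_distributed (d : measure_display)
    (T : measurableType d) (R : realType) (P : probability T R) (I : Type)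
    (X : I -> {RV P >-> R}) : Prop :=
  forall (i j : I) (A : set R), measurable A ->
    distribution P (X i) A = distribution P (X j) A.

Definition iid (d : measure_display) (T : measurableType d) (R : realType)
    (P : probability T R) (I : choiceType) (X : I -> {RV P >-> R}) : Prop :=
  mutually_independent X /\ identically_distributed X.

Definition nondegenerate_rv (d : measure_display) (T : measurableType d)
    (R : realType) (P : probability T R) (X : {RV P >-> R}) : Prop :=
  ~ exists a : R, P (X @^-1` [set a]) = 1%E.

Definition slowly_varying (R : realType) (f : R -> R) : Prop :=
  [/\ measurable_fun setT f,
      \forall t \near +oo, 0 < f t
    & forall l : R, 0 < l -> f (l * t) / f t @[t --> +oo] --> (1 : R)].

(* The sum of a family with infinite support is 0 and mup x 0 = 0, so the zero
   polynomial gets the value 0. *)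
Definition num_roots (R : realType) (q : {poly R}) : nat :=
  \sum_(x \in [set x : R | root q x]) mup x q.

Definition random_poly (d : measure_display) (T : measurableType d)
    (R : realType) (P : probability T R) (X : nat -> {RV P >-> R}) (n : nat)
    (w : T) : {poly R} :=
  \poly_(k < n.+1) X k w.

(* Measurability of the X n is part of the notion: the integral of a
   non-measurable function has a junk value. *)
Definition cvg_in_distribution (d d' : measure_display)
    (T : measurableType d) (T' : measurableType d') (R : realType)
    (P : probability T R) (Q : probability T' R)
    (X : nat -> T -> R) (Y : {RV Q >-> R}) : Prop :=
  (forall n, measurable_fun setT (X n)) /\
  forall f : R -> R, continuous f -> bounded_fun f ->
    ('E_P[f \o X n] @[n --> \oo] --> 'E_Q[f \o Y])%E.

(* Main.v *)
Require Import Defs.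
From HB Require Import structures.
From mathcomp Require Import all_boot all_order all_algebra finmap.
From mathcomp Require Import all_classical all_reals all_analysis.
From mathcomp Require Import measurable_realfun.
From mathcomp Require Import polyorder polyrcf ring lra zify.

(** Why the theorem holds.

    Since the tail of log|xi_0| is slowly varying, one of the coefficients
    xi_1, ..., xi_(n-1), say xi_j, is with high probability so much larger than
    all the others that the polynomial behaves on [-1, 1] like xi_0 + xi_j z^j,
    and outside of it like xi_j z^j + xi_n z^n.  The number of
    real roots is then a function of the parities of n and j and of the signs
    of xi_0, xi_j and xi_n ([num_roots_dominated]): the binomial
    xi_0 + xi_j z^j has a root in (0, 1) iff xi_0 xi_j < 0, and substituting -z
    and 1/z gives the roots in (-1, 0), (1, oo) and (-oo, -1).  In the limit, j
    is even with probability 1/2, xi_j is positive with probability c, xi_0 and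
    xi_n are positive with probability p, and these four events are
    independent.

    Comparing xi_j with the second largest coefficient is not enough, because
    log|xi_j| need not exceed n times the logarithm of the second largest one.
    What is true is that log|xi_k| is at most (min(k, n - k) / 4n) log|xi_j|
    with high probability: the expected number of k such that
    log|xi_k| > (min(k, n - k) / 4n) y is asymptotically the same as the
    expected number n F(y) of k such that log|xi_k| > y, where F is the tail of
    log|xi_0| ([karamata_sum_min], from the Potter bound [potter_bound]).

    The probabilities of the 16 parity and sign patterns sum to one in the
    limit, so it suffices to bound each of them from below.  Along the dyadic
    levels y_i = 2^i t, the events [coef_pattern] (log|xi_j| lies in
    (y_i, y_(i+1)], the other interior coefficients satisfy the bound above
    with y = y_i, and xi_0, xi_n have prescribed signs and moderate sizes)
    are disjoint for distinct j, i and signs ([coef_pattern_inj]), and each of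
    them is a product event, whose probability is given by independence
    ([coef_pattern_prob]).  Summing over i amounts to integrating
    n (1 - F)^(n-1) dF, which is close to 1, and an Abel summation brings in the
    limit ratio c ([levels_exist]).  Lower bounds for all classes give the
    convergence in distribution to the mixture of Dirac masses
    ([cvg_in_distribution_mixture]).

    Convergence in distribution also requires the number of roots to be a
    measurable function ([measurable_num_roots]); it is a limit of numbers of
    cells, of a finer and finer grid, that meet the root set. *)

Set Implicit Arguments.
Unset Strict Implicit.
Unset Printing Implicit Defensive.

Import Order.TTheory GRing.Theory Num.Theory.
Import numFieldNormedType.Exports.

Local Open Scope classical_set_scope.
Local Open Scope ring_scope.

(** * Counting simple roots region by region *)

(** The bound on the number of roots is obtained separately on (0, 1), (-1, 0),
    (1, oo) and (-oo, -1).  Asking for simple roots makes the count insensitive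
    to multiplicities, so that it can be transported by z -> -z and z -> 1/z. *)
Definition simple_roots (R : realType) (p : {poly R}) (D : pred R) (m : nat) :=
  exists s : seq R, [/\ uniq s, size s = m,
    forall x, (x \in s) = D x && root p x
  & forall x, x \in s -> ~~ root p^`() x].

Lemma mup_simple_root (R : realType) (p : {poly R}) (x : R) :
  root p x -> ~~ root p^`() x -> mup x p = 1%N.
Proof.
move=> rx nrx; have p0 : p != 0.
  by apply: contraNneq nrx => ->; rewrite deriv0 root0.
apply/eqP; rewrite eqn_leq; apply/andP; split; last first.
  by rewrite mup_geq// expr1 dvdp_XsubCl.
rewrite -ltnS mup_ltn//; apply: contra nrx => /dvdpP[r ->].
rewrite exprS expr1 !derivM rootE !(hornerD, hornerM).
by rewrite hornerN hornerX hornerC subrr !(mul0r, mulr0, addr0).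
Qed.

Lemma simple_rootsU (R : realType) (p : {poly R}) (D1 D2 : pred R) m1 m2 :
  (forall x, D1 x -> ~~ D2 x) ->
  simple_roots p D1 m1 -> simple_roots p D2 m2 ->
  simple_roots p (predU D1 D2) (m1 + m2).
Proof.
move=> D12 [s1 [us1 <- s1P s1d]] [s2 [us2 <- s2P s2d]].
exists (s1 ++ s2); split => [||x|x].
- rewrite cat_uniq us1 us2 andbT/=; apply/hasPn => x; rewrite s2P.
  by move=> /andP[D2x _]; rewrite s1P; apply: contraL D2x => /andP[/D12].
- by rewrite size_cat.
- by rewrite mem_cat s1P s2P/= andb_orl.
- by rewrite mem_cat => /orP[/s1d|/s2d].
Qed.

(** Both symmetries z -> -z and z -> 1/z are involutions of the field (the inverse
    of 0 being 0), so the same map carries roots back and forth. *)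
Lemma simple_roots_involutive (R : realType) (p q : {poly R}) (D E : pred R)
    (f : R -> R) m :
  involutive f -> (forall x, E x = D (f x)) ->
  (forall x, E x -> root q x = root p (f x)) ->
  (forall x, E x -> root q x -> root q^`() x -> root p^`() (f x)) ->
  simple_roots p D m -> simple_roots q E m.
Proof.
move=> fK ED qp q'p' [s [us <- sP sd]]; exists (map f s); split => [||x|x].
- by rewrite map_inj_uniq//; exact: can_inj fK.
- by rewrite size_map.
- rewrite -{1}(fK x) mem_map ?sP -?ED; last exact: can_inj fK.
  by case: (boolP (E x)) => //= Ex; rewrite qp.
- rewrite -{1}(fK x) mem_map; last exact: can_inj fK.
  move=> fs; move: (fs); rewrite sP -ED => /andP[Ex pfx].
  by apply: contra (sd _ fs); apply: q'p' => //; rewrite qp.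
Qed.

Lemma num_roots_simple (R : realType) (p : {poly R}) (D : pred R) m :
  (forall x, root p x -> D x) -> simple_roots p D m -> num_roots p = m.
Proof.
move=> Dp [s [us <- sP sd]]; rewrite /num_roots.
have -> : [set x : R | root p x] = [set` s].
  apply/seteqP; split => x /=; rewrite sP; last by case/andP.
  by move=> px; rewrite px Dp.
rewrite -fsbig_seq//= big_seq (eq_bigr (fun=> 1%N)).
  by rewrite -big_seq sum1_size.
move=> x xs; apply: mup_simple_root; last exact: sd.
by move: xs; rewrite sP => /andP[].
Qed.

Definition negseq (R : realType) (a : nat -> R) k := (-1) ^+ k * a k.
Definition revseq (R : realType) (n : nat) (a : nat -> R) k := a (n - k)%N.

(** The operator z d/dz is preferred to the derivative: it multiplies the k-th
    term by k, and behaves well under z -> -z and z -> 1/z. *)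
Lemma horner_deriv_poly (R : realType) n (a : nat -> R) x :
  x * (\poly_(k < n.+1) a k)^`().[x] =
  \sum_(k < n.+1) k%:R * a k * x ^+ k.
Proof.
rewrite poly_def raddf_sum horner_sum mulr_sumr; apply: eq_bigr => k _.
rewrite /= derivZ derivXn hornerZ hornerMn hornerXn.
case: (k : nat) => [|l]; first by rewrite mulr0n mulr0 !mul0r mulr0.
by rewrite -mulr_natl exprS/=; ring.
Qed.

Lemma horner_negseq (R : realType) n (a : nat -> R) x :
  (\poly_(k < n.+1) negseq a k).[x] = (\poly_(k < n.+1) a k).[- x].
Proof.
rewrite !horner_poly; apply: eq_bigr => k _.
by rewrite /negseq (exprNn x) (mulrC _ (a k)) mulrA.
Qed.

Lemma simple_roots_neg (R : realType) n (a : nat -> R) (D : pred R) m :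
  (forall x, D x -> x != 0) ->
  simple_roots (\poly_(k < n.+1) negseq a k) D m ->
  simple_roots (\poly_(k < n.+1) a k) (fun x => D (- x)) m.
Proof.
move=> D0; apply: simple_roots_involutive => [x|//|x Dx|x Dx rx].
- by rewrite opprK.
- by rewrite !rootE horner_negseq opprK.
- move: (D0 _ Dx) => x0; rewrite !rootE => /eqP px0.
  apply/eqP/(mulfI x0); rewrite mulr0 horner_deriv_poly.
  have := mulr0 x; rewrite -{1}px0 horner_deriv_poly; apply: etrans.
  apply: eq_bigr => k _.
  by rewrite /negseq (exprNn x) (mulrCA k%:R) mulrACA -expr2 sqrr_sign mul1r.
Qed.

Lemma horner_revseq (R : realType) n (a : nat -> R) x : x != 0 ->
  (\poly_(k < n.+1) revseq n a k).[x^-1] = x ^- n * (\poly_(k < n.+1) a k).[x].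
Proof.
move=> x0; rewrite !horner_poly mulr_sumr (reindex_inj rev_ord_inj)/=.
apply: eq_bigr => k _; have kn : (k <= n)%N by rewrite -ltnS.
rewrite /revseq subSS subKn// mulrCA; congr (_ * _).
by rewrite exprVn expfB_cond ?(negPf x0)// invfM invrK mulrC.
Qed.

(** With q the reversed polynomial, q(1/x) = x^-n p(x), hence
    (z q')(1/x) = x^-n (n p(x) - x p'(x)): at a root of p, the derivative of q
    vanishes only if the one of p does. *)
Lemma simple_roots_rev (R : realType) n (a : nat -> R) (D : pred R) m :
  (forall x, D x -> x != 0) ->
  simple_roots (\poly_(k < n.+1) revseq n a k) D m ->
  simple_roots (\poly_(k < n.+1) a k) (fun x => D x^-1) m.
Proof.
move=> D0; apply: simple_roots_involutive => [x|//|x Dx|x Dx rx].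
- by rewrite invrK.
- have x0 : x != 0 by rewrite -invr_eq0; exact: D0.
  by rewrite !rootE horner_revseq// mulf_eq0 invr_eq0 expf_eq0 (negPf x0) andbF.
- have x0 : x != 0 by rewrite -invr_eq0; exact: D0.
  rewrite !rootE => /eqP px0.
  apply/eqP/(mulfI (D0 _ Dx)); rewrite mulr0 horner_deriv_poly.
  have E : n%:R * (x ^- n * (\poly_(k < n.+1) a k).[x]) -
      x ^- n * (x * (\poly_(k < n.+1) a k)^`().[x]) = 0.
    by move: rx; rewrite rootE px0 => /eqP ->; rewrite !mulr0 subr0.
  apply: etrans E; rewrite -horner_revseq// horner_deriv_poly horner_poly.
  rewrite !mulr_sumr (reindex_inj rev_ord_inj)/=.
  rewrite [X in _ = _ - X](reindex_inj rev_ord_inj)/= -sumrB.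
  rewrite (reindex_inj rev_ord_inj)/=; apply: eq_bigr => k _.
  have kn : (k <= n)%N by rewrite -ltnS.
  rewrite !subSS !subKn// /revseq.
  have -> : x ^+ (n - k) = x ^+ n * x^-1 ^+ k by rewrite exprVn expfB_cond ?(negPf x0).
  rewrite natrB//.
  have xn : x ^+ n != 0 by rewrite expf_neq0.
  by rewrite [x ^- n * _]mulrCA (mulrA (x ^- n)) mulVf// mul1r; ring.
Qed.

(** * Polynomials with one overwhelming coefficient *)

(** On the logarithmic scale the coefficients other than [a t] lie below a tent of
    slope log q standing on both ends, while [a t] exceeds every point of this
    tent by far.  The condition is symmetric, so that it survives the reversal
    of the coefficients. *)
Definition dominated (R : realType) (a : nat -> R) (n t : nat) (q K : R) :=
  [/\ (0 < t < n)%N,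
      q ^+ (4 * n) <= `|a t|,
      forall k, (0 < k < n)%N -> k != t -> `|a k| <= q ^+ minn k (n - k)
    & K^-1 <= `|a 0%N| <= K /\ K^-1 <= `|a n| <= K].

Lemma dominated_neg (R : realType) (a : nat -> R) n t q K :
  dominated a n t q K -> dominated (negseq a) n t q K.
Proof.
have E k : `|negseq a k| = `|a k| by rewrite /negseq normrMsign.
by move=> [tn at_ ak a0n]; split; rewrite ?E// => k kn kt; rewrite E ak.
Qed.

Lemma dominated_rev (R : realType) (a : nat -> R) n t q K :
  dominated a n t q K -> dominated (revseq n a) n (n - t) q K.
Proof.
move=> [tn at_ ak a0n]; have [t0 ltn] := andP tn.
split; rewrite /revseq ?subnn ?subn0 ?subKn ?(ltnW ltn)//; first by lia.
- move=> k kn kt; have -> : minn k (n - k) = minn (n - k) (n - (n - k)) by lia.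
  by apply: ak; lia.
- by case: a0n.
Qed.

Lemma sum_split0t (R : realType) n t (F : nat -> R) : (0 < t < n)%N ->
  \sum_(k < n.+1) F k =
  F 0%N + F t + \sum_(k < n.+1 | ((k : nat) != 0%N) && ((k : nat) != t)) F k.
Proof.
move=> /andP[t0 tn]; have tn1 : (t < n.+1)%N by rewrite ltnS ltnW.
rewrite (bigD1 ord0)//= (bigD1 (Ordinal tn1))/=; last by rewrite -lt0n.
by rewrite addrA; congr (_ + _).
Qed.

Section Dominated.
Variables (R : realType) (a : nat -> R) (n t : nat) (q K : R).
Hypotheses (K1 : 1 <= K) (Kq : 8 * K * n.+1%:R ^+ 2 <= q).
Hypothesis dom : dominated a n t q K.

Let n1 : 1 <= n.+1%:R :> R. Proof. by rewrite ler1n. Qed.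
Let KleQ : K <= q.
Proof.
apply: le_trans Kq; have : 1 <= n.+1%:R ^+ 2 :> R by rewrite exprn_ege1.
by move: K1; nra.
Qed.
Let q1 : 1 <= q. Proof. exact: le_trans KleQ. Qed.
Let q0 : 0 < q. Proof. exact: lt_le_trans q1. Qed.
Let top_large : 2 * K <= `|a t|.
Proof.
have [/andP[t0 tn] aat _ _] := dom; apply: le_trans aat.
apply: (@le_trans _ _ (q ^+ 1)); last first.
  by rewrite ler_weXn2l// muln_gt0 (ltn_trans t0 tn).
rewrite expr1; apply: le_trans Kq.
have : 1 <= n.+1%:R ^+ 2 :> R by rewrite exprn_ege1.
by move: K1; nra.
Qed.

(** For k < t write q z = q^-1 (q^2 z): the k-th power of q^2 z is at most 1 or at
    most its t-th power, and q^(2 t) is absorbed by |a t|.  For k > t, z^k is at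
    most z^t.  In both cases a factor q^-1 is gained. *)
Lemma dominated_term z k : 0 <= z <= 1 -> (0 < k <= n)%N -> k != t ->
  `|a k| * z ^+ k <= q^-1 * (1 + `|a t| * z ^+ t).
Proof.
move=> /andP[z0 z1] /andP[k0 kn] kt.
have [/andP[t0 tn] aat ak [_ /andP[_ an]]] := dom.
have mz0 : 0 <= `|a t| * z ^+ t by rewrite mulr_ge0 ?exprn_ge0.
have [ltkt|lekt] := ltnP k t.
- have akq : `|a k| <= q ^+ k.
    apply: le_trans (ak _ _ kt) _; first by rewrite k0 (ltn_trans ltkt).
    by rewrite ler_weXn2l// geq_minl.
  set v := q ^+ 2 * z; have v0 : 0 <= v by rewrite mulr_ge0// exprn_ge0// ltW.
  have vX : v ^+ k <= 1 + `|a t| * z ^+ t.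
    have [v1|/ltW v1] := leP v 1; first by rewrite ler_wpDr// exprn_ile1.
    apply: le_trans (ler_weXn2l v1 (ltnW ltkt)) _; rewrite ler_wpDl//.
    rewrite /v exprMn -exprM ler_wpM2r ?exprn_ge0//.
    by apply: le_trans aat; rewrite ler_weXn2l// leq_mul// ltnW.
  apply: le_trans (_ : q ^+ k * z ^+ k <= _); first by rewrite ler_wpM2r ?exprn_ge0.
  rewrite -exprMn; have -> : q * z = q^-1 * v by rewrite /v; field; rewrite gt_eqF.
  rewrite exprMn; apply: ler_pM => //; rewrite ?exprn_ge0 ?invr_ge0 ?(ltW q0)//.
  by rewrite -[leRHS]expr1 ler_wiXn2l ?invr_ge0 ?(ltW q0)// invf_le1.
- have akq : `|a k| <= q ^+ n.
    have [->|kn'] := eqVneq k n.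
      apply: le_trans an _; apply: le_trans KleQ _.
      by rewrite -[leLHS]expr1 ler_weXn2l// (ltn_trans t0 tn).
    apply: le_trans (ak _ _ kt) _; first by rewrite k0 ltn_neqAle kn' kn.
    by rewrite ler_weXn2l// (leq_trans (geq_minl _ _)).
  apply: le_trans (_ : q ^+ n * z ^+ t <= _).
    by apply: ler_pM => //; rewrite ?exprn_ge0// ler_wiXn2l.
  rewrite mulrDr mulr1 ler_wpDl ?invr_ge0 ?(ltW q0)//.
  rewrite mulrA ler_wpM2r ?exprn_ge0// ler_pdivlMl//.
  by apply: le_trans aat; rewrite -exprS ler_weXn2l//; clear -tn; lia.
Qed.

Lemma dominated_rest z : 0 <= z <= 1 ->
  \sum_(k < n.+1 | ((k : nat) != 0%N) && ((k : nat) != t))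
    k%:R * (`|a k| * z ^+ k) <= (8 * K)^-1 * (1 + `|a t| * z ^+ t).
Proof.
move=> z01; have /andP[z0 z1] := z01; set X := 1 + _.
have X0 : 0 <= X by rewrite addr_ge0// mulr_ge0// exprn_ge0.
apply: le_trans (_ : \sum_(k < n.+1) (n.+1%:R * (q^-1 * X)) <= _).
  rewrite big_mkcond; apply: ler_sum => k _.
  case: ifPn => [/andP[k0 kt]|_]; last by rewrite !mulr_ge0// invr_ge0 ltW.
  apply: ler_pM => //.
  - by rewrite mulr_ge0 ?exprn_ge0.
  - by rewrite ler_nat ltnW.
  - by apply: dominated_term => //; rewrite lt0n k0 -ltnS ltn_ord.
rewrite sumr_const card_ord -[leLHS]mulr_natl !mulrA ler_wpM2r//.
rewrite ler_pdivrMr// ler_pdivlMl; last by rewrite mulr_gt0// (lt_le_trans ltr01).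
by rewrite -expr2.
Qed.

Let p := \poly_(k < n.+1) a k.

(** On [0, 1] both p and z p' agree with those of the binomial a_0 + a_t z^t, up
    to an error that is small relative to the sizes of its two terms. *)
Lemma dominated_poly z : 0 <= z <= 1 ->
  `|p.[z] - (a 0%N + a t * z ^+ t)| <= (`|a 0%N| + `|a t| * z ^+ t) / 8 /\
  `|z * p^`().[z] - t%:R * (a t * z ^+ t)| <=
    (`|a 0%N| + `|a t| * z ^+ t) / 8.
Proof.
move=> z01; have /andP[z0 z1] := z01.
have [tn aat ak [/andP[a0 _] _]] := dom.
have K0 : 0 < K by apply: lt_le_trans K1.
have mz0 : 0 <= `|a t| * z ^+ t by rewrite mulr_ge0 ?exprn_ge0.
have B : (8 * K)^-1 * (1 + `|a t| * z ^+ t) <=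
    (`|a 0%N| + `|a t| * z ^+ t) / 8.
  rewrite invfM -mulrA [leLHS]mulrC ler_wpM2r ?invr_ge0//.
  have : K^-1 <= 1 by rewrite invf_le1.
  by rewrite mulrDr mulr1 => Ki; rewrite lerD// -[leRHS]mul1r ler_wpM2r.
have zk (k : nat) : `|z ^+ k| = z ^+ k by rewrite ger0_norm ?exprn_ge0.
rewrite horner_deriv_poly horner_poly.
rewrite (sum_split0t (fun k => a k * z ^+ k) tn).
rewrite (sum_split0t (fun k => k%:R * a k * z ^+ k) tn).
rewrite expr0 mulr1 !mul0r add0r -mulrA.
rewrite ![_ + \sum_(_ < _ | _) _]addrC !addrK.
split; (apply: le_trans (ler_norm_sum _ _ _) _; apply: le_trans B;
  apply: le_trans (dominated_rest z01)); apply: ler_sum => k /andP[k0 kt].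
- by rewrite normrM zk ler_peMl ?mulr_ge0 ?exprn_ge0// ler1n lt0n.
- by rewrite !normrM zk normr_nat mulrA.
Qed.

Lemma dominated_same_sign z : 0 < a 0%N * a t -> 0 <= z <= 1 -> ~~ root p z.
Proof.
move=> s z01; have [+ _] := dominated_poly z01; have /andP[z0 z1] := z01.
have zt : 0 <= z ^+ t by rewrite exprn_ge0.
apply: contraL => /eqP ->; rewrite sub0r normrN -ltNge.
have a0n : 0 < `|a 0%N|.
  by rewrite normr_gt0; apply: contraTneq s => ->; rewrite mul0r ltxx.
have -> : `|a 0%N + a t * z ^+ t| = `|a 0%N| + `|a t| * z ^+ t.
  have [a00|a00|E] := ltrgtP (a 0%N) 0; last by move: s; rewrite E mul0r ltxx.
  - have at0 : a t < 0 by move: s; rewrite nmulr_rgt0.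
    by rewrite !ltr0_norm//; [ring|nra].
  - have at0 : 0 < a t by move: s; rewrite pmulr_rgt0.
    by rewrite !ger0_norm ?(ltW at0) ?(ltW a00)//; nra.
have := mulr_ge0 (normr_ge0 (a t)) zt; lra.
Qed.

(** Let m = |a_t| z^t, an increasing function of z.  Up to the sign of a_t, p is
    negative as long as m < |a_0| / 2, while p' does not vanish from there on.
    Hence a root exists by the intermediate value theorem, it is simple, and
    two of them would contradict Rolle's theorem. *)
Lemma dominated_opp_sign : a 0%N * a t < 0 ->
  simple_roots p (fun x => 0 < x < 1) 1.
Proof.
move=> s; have [/andP[t0 tn] aat ak [/andP[_ a0K] _]] := dom.
(* after multiplication by the sign e of a t, p is close to |a t| z^t - |a 0| *)
have [e [e1 ea0 eat]] : exists e : R,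
    [/\ `|e| = 1, e * a 0%N = - `|a 0%N| & e * a t = `|a t|].
  have [at0|at0|E] := ltrgtP (a t) 0; last by move: s; rewrite E mulr0 ltxx.
  - exists (-1); rewrite normrN1 !mulN1r (ltr0_norm at0).
    by rewrite gtr0_norm//; move: s; rewrite nmulr_llt0.
  - exists 1; rewrite normr1 !mul1r (gtr0_norm at0).
    by rewrite ltr0_norm ?opprK//; move: s; rewrite pmulr_llt0.
have a0n : 0 < `|a 0%N|.
  by rewrite normr_gt0; apply: contraTneq s => ->; rewrite mul0r ltxx.
have P z : 0 <= z <= 1 -> let m := `|a t| * z ^+ t in
    `|e * p.[z] - (m - `|a 0%N|)| <= (`|a 0%N| + m) / 8 /\
    `|e * (z * p^`().[z]) - t%:R * m| <= (`|a 0%N| + m) / 8.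
  move=> z01 m; have [h1 h2] := dominated_poly z01; split.
    have -> : m - `|a 0%N| = e * (a 0%N + a t * z ^+ t).
      by rewrite mulrDr ea0 mulrA eat addrC.
    by rewrite -mulrBr normrM e1 mul1r.
  have -> : t%:R * m = e * (t%:R * (a t * z ^+ t)).
    by rewrite /m -eat; ring.
  by rewrite -mulrBr normrM e1 mul1r.
have e0 : e != 0 by rewrite -normr_gt0 e1.
have small z : 0 <= z <= 1 -> root p z -> `|a 0%N| / 2 <= `|a t| * z ^+ t.
  move=> z01 /eqP pz; have [+ _] := P z z01; rewrite pz mulr0 sub0r normrN.
  by rewrite ler_norml => /andP[]; lra.
have incr z : 0 < z <= 1 -> `|a 0%N| / 2 <= `|a t| * z ^+ t ->
    p^`().[z] != 0.
  move=> /andP[z0 z1] mz; have [|_ +] := P z; first by rewrite ltW.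
  apply: contraTneq => ->; rewrite !mulr0 sub0r normrN -ltNge.
  have t1 : 1 <= t%:R :> R by rewrite ler1n.
  have mz0 : 0 <= `|a t| * z ^+ t by rewrite mulr_ge0 ?exprn_ge0 ?(ltW z0).
  have := ler_peMl mz0 t1.
  by rewrite (ger0_norm (mulr_ge0 _ mz0))//; lra.
have p0 : e * p.[0] < 0.
  by rewrite horner_poly big_ord_recl/= expr0 mulr1 big1 => [|i _];
    rewrite ?expr0n ?mulr0// addr0 ea0 oppr_lt0.
have p1 : 0 < e * p.[1].
  have [|+ _] := P 1; first by rewrite ler01 lexx.
  rewrite expr1n mulr1 ler_norml => /andP[h _].
  have := top_large; lra.
have [x x01 rx] : {x : R | x \in `]0, 1[ & root p x}.
  apply: poly_ivtoo => //.
  have : (e * p.[0]) * (e * p.[1]) < 0 by rewrite nmulr_rlt0.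
  by rewrite mulrACA pmulr_rlt0// -expr2 exprn_even_gt0.
rewrite in_itv/= in x01; have /andP[x0 x1] := x01.
exists [:: x]; split => // [y|y]; rewrite inE; last first.
  move=> /eqP ->; rewrite rootE; apply: incr; first by rewrite x0 ltW.
  by apply: small => //; rewrite !ltW.
apply/eqP/idP => [->|/andP[/andP[y0 y1] ry]]; first by rewrite x01.
wlog xy : x y x0 x1 y0 y1 rx ry {x01} / x < y.
  by move=> W; have [/W->|/W->|->] := ltrgtP x y.
have [|c + /eqP] := poly_rolle (p := p) xy.
  by rewrite (eqP rx) (eqP ry).
rewrite in_itv/= => /andP[xc cy].
apply: contraTeq => _; apply: incr; first by apply/andP; split; lra.
have xI : 0 <= x <= 1 by apply/andP; split; lra.
apply: le_trans (small x xI rx) _.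
by rewrite ler_wpM2l// lerXn2r ?nnegrE//; lra.
Qed.

Lemma dominated_roots01 :
  simple_roots p (fun x => 0 < x < 1) (a 0%N * a t < 0)%R.
Proof.
have [/andP[t0 tn] aat ak [/andP[a0K _] _]] := dom.
have [s|s|s] := ltrgtP (a 0%N * a t) 0; first exact: dominated_opp_sign.
- exists [::]; split => // x; rewrite in_nil; apply/esym/negbTE.
  apply/negP => /andP[/andP[x0 x1] rx].
  by move: rx; apply/negP/dominated_same_sign => //; rewrite !ltW.
- have : 0 < `|a 0%N * a t|.
    rewrite normrM mulr_gt0//.
      by apply: lt_le_trans a0K; rewrite invr_gt0 (lt_le_trans ltr01).
    by apply: lt_le_trans aat; rewrite exprn_gt0.
  by rewrite s normr0 ltxx.
Qed.

Lemma dominated_nroot01 : ~~ root p 0 /\ ~~ root p 1.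
Proof.
have [/andP[t0 tn] aat ak [/andP[a0K a0K'] _]] := dom.
have K0 : 0 < K by apply: lt_le_trans K1.
split.
  rewrite rootE horner_poly big_ord_recl/= expr0 mulr1 big1 => [|i _];
    rewrite ?expr0n ?mulr0// addr0.
  by rewrite -normr_gt0 (lt_le_trans _ a0K) ?invr_gt0.
have [|+ _] := @dominated_poly 1; first by rewrite ler01 lexx.
apply: contraL => /eqP ->; rewrite sub0r normrN -ltNge expr1n !mulr1.
have := top_large.
have := ler_normB (a 0%N + a t) (a 0%N); rewrite addrAC subrr add0r.
lra.
Qed.

End Dominated.

(** The four summands count the roots in (0, 1), (-1, 0), (1, oo) and (-oo, -1).  The
    last three come from the first one, applied to p(-z), to the reversed
    polynomial and to the reversal of p(-z). *)
Lemma num_roots_dominated (R : realType) (a : nat -> R) (n t : nat) (q K : R) :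
  1 <= K -> 8 * K * n.+1%:R ^+ 2 <= q -> dominated a n t q K ->
  num_roots (\poly_(k < n.+1) a k) =
    ((a 0 * a t < 0)%R + ((-1) ^+ t * (a 0 * a t) < 0)%R +
     ((a n * a t < 0)%R + ((-1) ^+ (n + t) * (a n * a t) < 0)%R))%N.
Proof.
move=> K1 Kq dom; set p := \poly_(k < n.+1) a k.
have [/andP[t0 tn] _ _ _] := dom.
have pos01 (x : R) : 0 < x < 1 -> x != 0 by case/andP => /gt_eqF ->.
have domN := dominated_neg dom.
have domR := dominated_rev dom.
have domNR := dominated_rev domN.
have S1 : simple_roots p (fun x => 0 < x < 1) (a 0 * a t < 0)%R.
  exact: dominated_roots01 dom.
have S2 : simple_roots p (fun x => 0 < - x < 1)
    ((-1) ^+ t * (a 0 * a t) < 0)%R.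
  have := simple_roots_neg pos01 (dominated_roots01 K1 Kq domN).
  by rewrite /negseq expr0 mul1r mulrCA.
have S3 : simple_roots p (fun x => 0 < x^-1 < 1) (a n * a t < 0)%R.
  have := simple_roots_rev pos01 (dominated_roots01 K1 Kq domR).
  by rewrite /revseq subn0 subKn// ltnW.
have S4 : simple_roots p (fun x => 0 < (- x)^-1 < 1)
    ((-1) ^+ (n + t) * (a n * a t) < 0)%R.
  have := simple_roots_rev pos01 (dominated_roots01 K1 Kq domNR).
  have -> : (-1) ^+ (n + t) * (a n * a t) = negseq a n * negseq a t.
    by rewrite /negseq mulrACA exprD.
  rewrite /revseq subn0 subKn; last exact: ltnW.
  apply: simple_roots_neg => x.
  by move=> /andP[+ _]; rewrite invr_gt0 => /gt_eqF ->.
have [r0 r1] := dominated_nroot01 K1 Kq dom.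
have [_ rN1] := dominated_nroot01 K1 Kq domN.
have inv1 (x : R) : (0 < x^-1 < 1) = (1 < x).
  rewrite invr_gt0; have [x0|x0] := ltP 0 x; first by rewrite invf_lt1.
  by apply/esym/negbTE; rewrite -leNgt (le_trans x0).
apply: (num_roots_simple (D := predU (predU (fun x => 0 < x < 1)
  (fun x => 0 < - x < 1)) (predU (fun x => 0 < x^-1 < 1)
  (fun x => 0 < (- x)^-1 < 1)))) => [x rx|].
  rewrite /= !inv1.
  have xN0 : x != 0 by apply: contraNneq r0 => <-.
  have xN1 : x != 1 by apply: contraNneq r1 => <-.
  have xNN1 : x != -1.
    apply: contraNneq rN1 => xE; rewrite rootE horner_negseq -xE.
    exact: rx.
  have [x0|x0|/eqP] := ltrgtP x 0; last by rewrite (negPf xN0).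
    rewrite oppr_gt0 x0; have [h|h|h] := ltrgtP (- x) 1; rewrite ?orbT//.
    by move: xNN1; rewrite -h opprK eqxx.
  have [h|h|/eqP] := ltrgtP x 1; rewrite ?orbT//.
  by rewrite (negPf xN1).
by apply: simple_rootsU; first (move=> x /=; rewrite !inv1; lra);
  apply: simple_rootsU => // x /=; rewrite ?inv1; lra.
Qed.

(** * Measurability of the number of roots *)

(** A continuous nonnegative function has a zero in [a, b] iff the function g
    obtained by adding the distance to [a, b] takes arbitrarily small values
    on a neighborhood of [a, b]: by compactness g attains its minimum.  By
    density, rational points suffice, which leaves countable operations. *)
Lemma measurable_exists_zero d (T : measurableType d) (R : realType)
    (f : R -> T -> R) (a b : R) :
  (forall x, measurable_fun setT (f x)) ->
  (forall w, continuous (f^~ w)) -> (forall x w, 0 <= f x w) ->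
  measurable [set w | exists x, a <= x <= b /\ f x w = 0].
Proof.
move=> mf cf f0.
pose g x w := f x w + (Num.max (a - x) 0 + Num.max (x - b) 0).
have d0 x : 0 <= Num.max (a - x) 0 + Num.max (x - b) 0.
  by rewrite addr_ge0// le_max lexx orbT.
have cg w : continuous (g^~ w).
  move=> x; apply: cvgD; first exact: cf.
  apply: cvgD.
    apply: (@continuous_max _ _ (fun x => a - x) (cst 0)); last exact: cvg_cst.
    by apply: cvgB; [exact: cvg_cst|exact: cvg_id].
  apply: (@continuous_max _ _ (fun x => x - b) (cst 0)); last exact: cvg_cst.
  by apply: cvgB; [exact: cvg_id|exact: cvg_cst].
have mg x : measurable_fun setT (g x).
  by apply: measurable_funD => //; exact: measurable_cst.
pose A k (q : rat) : set T :=
  [set w | a - 1 < ratr q < b + 1 /\ g (ratr q) w < k.+1%:R^-1].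
have mA k q : measurable (A k q).
  have [qab|qab] := boolP (a - 1 < ratr q < (b + 1 : R)); last first.
    by rewrite (_ : A k q = set0)//; apply/seteqP; split => w //= [/(negP qab)].
  rewrite (_ : A k q = [set w | g (ratr q) w < k.+1%:R^-1]); last first.
    by apply/seteqP; split => w //= [].
  rewrite -[X in measurable X]setTI.
  rewrite (_ : [set w | _] = g (ratr q) @^-1` `]-oo, k.+1%:R^-1[); last first.
    by apply/seteqP; split => w /=; rewrite in_itv.
  by apply: mg.
suff -> : [set w | exists x, a <= x <= b /\ f x w = 0] =
    \bigcap_k \bigcup_q A k q.
  by apply: bigcap_measurable => // k _; exact: bigcupT_measurable_rat.
apply/seteqP; split => w /=.
  move=> [x [/andP[ax xb] fx]] k _.
  have gx : g x w = 0.
    by rewrite /g fx (max_idPr _) ?(max_idPr _) ?subr_le0// !addr0.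
  have ok : open (`]a - 1, b + 1[ `&` (g^~ w) @^-1` [set y | y < k.+1%:R^-1]).
    apply: openI; first exact: interval_open.
    by apply: open_comp; [move=> y _; exact: cg|exact: open_lt].
  have ne : (`]a - 1, b + 1[ `&` (g^~ w) @^-1` [set y | y < k.+1%:R^-1]) !=set0.
    exists x; split; first by rewrite /= in_itv/=; apply/andP; split; lra.
    by rewrite /= gx invr_gt0.
  have [y [[yab gy] [q _ qy]]] := dense_rat ne ok.
  by exists q => //; split; rewrite qy//; move: yab; rewrite /= in_itv.
move=> H; have [x xab xmin] : exists2 c, c \in `[a - 1, b + 1] &
    forall t, t \in `[a - 1, b + 1] -> g c w <= g t w.
  apply: EVT_min.
    have [q _ [/andP[q1 q2] _]] := H 0%N I.
    by apply: le_trans (ltW q1) (ltW q2).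
  exact/continuous_subspaceT/cg.
have gx0 : g x w = 0.
  apply/eqP; rewrite eq_le; apply/andP; split; last by rewrite addr_ge0.
  rewrite leNgt; apply/negP => gx.
  have [k _ kP] := @near_infty_natSinv_lt R (PosNum gx).
  have [q _ [/andP[q1 q2] gq]] := H k I.
  have qI : ratr q \in `[a - 1, b + 1] by rewrite in_itv/= !ltW.
  have kg : k.+1%:R^-1 < g x w := kP k (leqnn k).
  by have := lt_trans gq kg; rewrite ltNge xmin.
exists x; move: (f0 x w) gx0 (d0 x); rewrite /g => h1 h2 h3.
have E : Num.max (a - x) 0 + Num.max (x - b) 0 = 0 by lra.
have [m1 m2] : 0 <= Num.max (a - x) 0 /\ 0 <= Num.max (x - b) 0.
  by rewrite !le_max lexx !orbT.
split; last lra.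
have : a - x <= Num.max (a - x) 0 by rewrite le_max lexx.
have : x - b <= Num.max (x - b) 0 by rewrite le_max lexx.
by move=> ? ?; apply/andP; split; lra.
Qed.

Lemma mup_gt (R : realType) (p : {poly R}) x j : p != 0 ->
  (j < mup x p)%N = [forall i : 'I_j.+1, root p^`(i) x].
Proof.
have mupE (q : {poly R}) : q != 0 -> mup x q = \mu_x q.
  move=> q0; apply/eqP; rewrite eqn_leq -root_le_mu// -mup_geq// leqnn/=.
  by rewrite mup_geq// root_le_mu// leqnn.
elim: j p => [|j IH] p p0.
  rewrite mupE// mu_gt0//; apply/idP/forallP => [rp i|/(_ ord0)//].
  by rewrite ord1.
have [rx|nrx] := boolP (root p x); last first.
  rewrite mupNroot//; apply/esym/negbTE; apply/negP => /forallP/(_ ord0).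
  by rewrite derivn0 (negPf nrx).
have [p'0|p'0] := eqVneq p^`() 0.
  have /size_poly1P[c c0 pE] : size p == 1%N.
    move: p'0 => /(congr1 (fun q : {poly R} => size q)).
    rewrite size_deriv size_poly0; have : size p != 0%N by rewrite size_poly_eq0.
    by case: (size p) => [|[|]].
  by move: rx; rewrite pE rootC (negPf c0).
have : mup x p = (mup x p^`()).+1 by rewrite !mupE// mu_deriv_root// addn1.
move=> ->; rewrite ltnS IH//; apply/forallP/forallP => [H i|H i].
  have [->|/prednK iS] := posnP i; first by rewrite derivn0.
  have ij : (i.-1 < j.+1)%N by rewrite -ltnS iS.
  by have := H (Ordinal ij); rewrite /= -derivSn iS.
have ij : (i.+1 < j.+2)%N by rewrite ltnS.
by rewrite -derivSn; exact: (H (Ordinal ij)).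
Qed.

(** This turns a number of cells that meet the root set into a number of roots. *)
Lemma sum_hits (I J : eqType) (f : J -> I) (s : seq I) (r : seq J)
    (Q : pred J) :
  uniq s -> uniq r -> {in r &, injective f} -> {in r, forall x, f x \in s} ->
  (forall x, Q x -> x \in r) ->
  (\sum_(z <- s) `[< exists x, f x = z /\ Q x >] = \sum_(x <- r) Q x)%N.
Proof.
move=> us ur finj fs Qr.
have sumE (K : eqType) (t : seq K) (B : pred K) :
    (\sum_(z <- t) B z = size ([seq z <- t | B z]))%N.
  by rewrite size_filter -sum1_count [RHS]big_mkcond; apply: eq_bigr => z _; case: (B z).
rewrite (sumE _ s (fun z => `[< exists x, f x = z /\ Q x >])) sumE.
rewrite -(size_map f [seq x <- r | Q x]); apply: perm_size; apply: uniq_perm.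
- exact: filter_uniq.
- rewrite map_inj_in_uniq ?filter_uniq// => x y.
  by rewrite !mem_filter => /andP[_ xr] /andP[_ yr]; exact: finj.
- move=> z; rewrite mem_filter; apply/andP/mapP.
    by move=> [/asboolP[x [<- Qx]] _]; exists x; rewrite // mem_filter Qx Qr.
  move=> [x]; rewrite mem_filter => /andP[Qx xr] ->; split; last exact: fs.
  by apply/asboolP; exists x.
Qed.

Lemma near_seq (I : eqType) (s : seq I) (Q : I -> nat -> Prop) :
  (forall x, x \in s -> \forall m \near \oo, Q x m) ->
  \forall m \near \oo, forall x, x \in s -> Q x m.
Proof.
elim: s => [_|x s IH H]; first by apply: nearW => m y; rewrite in_nil.
have Hx : \forall m \near \oo, Q x m by apply: H; rewrite mem_head.
have Hs : \forall m \near \oo, forall y, y \in s -> Q y m.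
  by apply: IH => y ys; apply: H; rewrite inE ys orbT.
near=> m => y; rewrite inE => /orP[/eqP ->|]; first by near: m.
by move: y; near: m.
Unshelve. all: by end_near. Qed.

(** Points are distributed among the cells [z/m, (z+1)/m) of mesh 1/m; the list
    [cells m] of the cells that meet [-m, m) grows to cover the line while the
    mesh vanishes. *)
Definition cell (R : realType) (m : nat) (x : R) : int := Num.floor (x * m%:R).
Definition cells (m : nat) : seq int :=
  [seq i%:Z - (m ^ 2)%:Z | i <- iota 0 (2 * m ^ 2)].

Lemma cells_uniq m : uniq (cells m).
Proof.
rewrite map_inj_uniq ?iota_uniq// => i j /eqP.
by rewrite (inj_eq (addIr _)) eqz_nat => /eqP.
Qed.

Lemma near_cell_range (R : realType) (x : R) :
  \forall m \near \oo, cell m x \in cells m.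
Proof.
near=> m; apply/mapP.
have xm : `|x| < m%:R by near: m; exact: nbhs_infty_gtr.
have m0 : 0 < m%:R :> R by exact: le_lt_trans xm.
have : (- (m ^ 2)%:Z <= cell m x < (m ^ 2)%:Z)%R.
  move: xm; rewrite ltr_norml => /andP[xm1 xm2].
  rewrite /cell floor_ge_int_tmp floor_lt_int rmorphN /= -!pmulrn !natrX expr2.
  by rewrite -mulNr ler_pM2r// ltr_pM2r// xm2 ltW.
move=> /andP[h1 h2]; exists (absz (cell m x + (m ^ 2)%:Z)); last by lia.
by rewrite mem_iota; lia.
Unshelve. all: by end_near. Qed.

Lemma near_cell_inj (R : realType) (x y : R) : x != y ->
  \forall m \near \oo, cell m x != cell m y.
Proof.
wlog xy : x y / x < y.
  move=> W xyN; have /orP[xy|yx] : (x < y) || (y < x) by rewrite -neq_lt.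
    exact: W.
  have := W y x yx; rewrite eq_sym => /(_ xyN); apply: filterS => m.
  by rewrite eq_sym.
move=> _; near=> m; apply/eqP => E.
have xm : (y - x)^-1 < m%:R by near: m; exact: nbhs_infty_gtr.
have /andP[h1 h2] := floor_itv (x * m%:R).
have /andP[h3 h4] := floor_itv (y * m%:R).
have d0 : 0 < y - x by rewrite subr_gt0.
have : 1 < (y - x) * m%:R by rewrite -ltr_pdivrMl// mulr1.
move: h1 h2 h3 h4; rewrite -!/(cell m _) E !rmorphD/= => *.
lra.
Unshelve. all: by end_near. Qed.

Lemma sum_ltn (N k : nat) : (k <= N)%N -> (\sum_(j < N) (j < k) = k)%N.
Proof.
move=> kN; rewrite -[RHS](card_ord k) -sum1_card (big_ord_widen _ (fun=> 1%N) kN).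
by rewrite [RHS]big_mkcond; apply: eq_bigr => j _; case: ifP.
Qed.

Lemma mup_lt_size (R : realType) (p : {poly R}) x : p != 0 ->
  (mup x p < size p)%N.
Proof.
move=> p0; have := leqnn (mup x p); rewrite mup_geq// => /dvdp_leq => /(_ p0).
by rewrite size_exp_XsubC.
Qed.

Lemma mup0 (R : realType) (x : R) : mup x 0 = 0%N.
Proof.
rewrite /mup; set i := [arg max_(_ > _ | _) _].
by have := ltn_ord i; rewrite {2}size_poly0 ltnS leqn0 => /eqP.
Qed.

Lemma num_rootsE (R : realType) (p : {poly R}) : p != 0 ->
  num_roots p = (\sum_(x <- rootsR p) mup x p)%N.
Proof.
move=> p0; rewrite /num_roots.
have -> : [set x : R | root p x] = [set` rootsR p].
  by apply/seteqP; split => x /=; rewrite -(roots_on_rootsR p0) in_itv.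
by rewrite -fsbig_seq//; exact: uniq_roots.
Qed.

(** As soon as the mesh separates the roots and the grid covers them, summing over
    j the number of cells containing a root of multiplicity greater than j
    counts each root with its multiplicity. *)
Lemma near_num_roots (R : realType) (p : {poly R}) n :
  p != 0 -> (size p <= n)%N ->
  \forall m \near \oo, num_roots p = (\sum_(j < n) \sum_(z <- cells m)
    `[< exists x : R, cell m x = z /\ (j < mup x p)%N >])%N.
Proof.
move=> p0 pn; have ur : uniq (rootsR p) by exact: uniq_roots.
have rP x : (0 < mup x p)%N -> x \in rootsR p.
  move=> x0; have := roots_on_rootsR p0 x; rewrite in_itv/= => <-.
  by apply: contraLR x0 => /mupNroot ->.
have H1 : \forall m \near \oo, forall x, x \in rootsR p -> cell m x \in cells m.
  by apply: near_seq => x _; exact: near_cell_range.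
have H2 : \forall m \near \oo, forall x, x \in rootsR p ->
    forall y, y \in rootsR p -> x != y -> cell m x != cell m y.
  apply: near_seq => x _; apply: near_seq => y _.
  have [->|xy] := eqVneq x y; first by apply: nearW.
  by apply: filterS (near_cell_inj xy).
near=> m; rewrite num_rootsE//.
have h1 : forall x, x \in rootsR p -> cell m x \in cells m by near: m.
have h2 : forall x, x \in rootsR p ->
    forall y, y \in rootsR p -> x != y -> cell m x != cell m y by near: m.
rewrite (eq_bigr (fun j : 'I_n => \sum_(x <- rootsR p) (j < mup x p))%N).
  rewrite exchange_big/=; apply: eq_bigr => x _.
  by rewrite sum_ltn// (leq_trans _ pn)// ltnW// mup_lt_size.
move=> j _; apply: (sum_hits (Q := fun x => (j < mup x p)%N)) => //.
- exact: cells_uniq.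
- move=> x y xr yr; apply: contra_eq => xy; exact: h2.
- by move=> x jx; apply: rP; exact: leq_trans jx.
Unshelve. all: by end_near. Qed.

Lemma derivn_polyE (R : realType) n (a : nat -> R) i x :
  (\poly_(k < n) a k)^`(i).[x] = \sum_(k < n) a k * ('X^k)^`(i).[x].
Proof.
rewrite poly_def linear_sum/= horner_sum; apply: eq_bigr => k _.
by rewrite derivnZ hornerZ.
Qed.

(** By [mup_gt], a point of multiplicity greater than j is a zero of
    the sum of the squares of the first j + 1 derivatives, to which
    [measurable_exists_zero] applies.  The cells being half-open, they are
    exhausted by compact intervals.  The zero polynomial, whose roots are
    counted as 0, is set apart. *)
Lemma measurable_num_roots d (T : measurableType d) (R : realType)
    (X : nat -> T -> R) n : (forall k, measurable_fun setT (X k)) ->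
  measurable_fun setT
    (fun w => (num_roots (\poly_(k < n) X k w))%:R : R).
Proof.
move=> mX; pose p w := \poly_(k < n) X k w.
pose hit j m z : set T :=
  [set w | p w != 0 /\ exists x : R, cell m x = z /\ (j < mup x (p w))%N].
have mhit j m z : measurable (hit j m.+1 z).
  pose f x w := \sum_(i < j.+1) (p w)^`(i).[x] ^+ 2.
  have mp x i : measurable_fun setT (fun w => (p w)^`(i).[x]).
    under eq_fun do rewrite derivn_polyE.
    by apply: measurable_sum => k; apply: measurable_funM.
  have mf x : measurable_fun setT (f x).
    by apply: measurable_sum => i; exact: measurable_funX.
  have cf w : continuous (f^~ w).
    rewrite (_ : f^~ w = horner (\sum_(i < j.+1) (p w)^`(i) ^+ 2)).
      exact: continuous_horner.
    apply/funext => x; rewrite horner_sum; apply: eq_bigr => i _.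
    by rewrite horner_exp.
  have f0 x w : 0 <= f x w by apply: sumr_ge0 => i _; exact: sqr_ge0.
  have m0 : 0 < m.+1%:R :> R by [].
  have -> : hit j m.+1 z = [set w | p w != 0] `&`
      \bigcup_l [set w | exists x, z%:~R / m.+1%:R <= x <=
        (z%:~R + 1 - l.+1%:R^-1) / m.+1%:R /\ f x w = 0].
    apply/seteqP; split => w /=.
      move=> [pw [x [/eqP]]]; rewrite /cell floor_eq => /andP[h1 h2] xj.
      split => //.
      have h3 : 0 < z%:~R + 1 - x * m.+1%:R.
        by rewrite subr_gt0; move: h2; rewrite rmorphD.
      have [l _ lP] := @near_infty_natSinv_lt R (PosNum h3).
      have lx : l.+1%:R^-1 < z%:~R + 1 - x * m.+1%:R := lP l (leqnn l).
      exists l => //; exists x; split.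
        by rewrite ler_pdivrMr// h1 ler_pdivlMr// lerBrDr -lerBrDl ltW.
      rewrite /f big1// => i _; move: xj; rewrite mup_gt// => /forallP/(_ i).
      by rewrite rootE => /eqP ->; rewrite expr0n.
    move=> [pw [l _ [x [/andP[h1 h2] fx]]]]; split => //; exists x; split.
      apply/eqP; rewrite /cell floor_eq -ler_pdivrMr// h1/=.
      move: h2; rewrite ler_pdivlMr// => /le_lt_trans; apply.
      by rewrite rmorphD/= ltrBlDr ltrDl invr_gt0.
    rewrite mup_gt//; apply/forallP => i; rewrite rootE.
    have := @psumr_eq0P _ _ xpredT (fun i : 'I_j.+1 => (p w)^`(i).[x] ^+ 2).
    move=> /(_ (fun i _ => sqr_ge0 _) fx i isT)/eqP.
    by rewrite expf_eq0.
  apply: measurableI; last first.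
    by apply: bigcup_measurable => l _; exact: measurable_exists_zero.
  have -> : [set w | p w != 0] = \bigcup_k [set w | (p w)`_k != 0].
    apply/seteqP; split => w /=.
      by move=> pw; exists (size (p w)).-1 => //=; rewrite -lead_coefE lead_coef_eq0.
    by move=> [k _ /=]; apply: contraNneq => ->; rewrite coef0.
  apply: bigcup_measurable => k _.
  have [kn|kn] := ltnP k n.
    rewrite (_ : [set w | _] = X k @^-1` (~` [set 0])); last first.
      by apply/seteqP; split => w /=; rewrite coef_poly kn => /eqP.
    by rewrite -[X in measurable X]setTI; apply: mX => //; exact: measurableC.
  rewrite (_ : [set w | _] = set0)//; apply/seteqP; split => w //=.
  by rewrite coef_poly ltnNge kn/= eqxx.
pose h m w := \sum_(j < n) \sum_(z <- cells m.+1) (\1_(hit j m.+1 z) w : R).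
apply: (@measurable_fun_cvg _ _ _ _ h) => [m|w _].
  by apply: measurable_sum => j; apply: measurable_sum => z; exact: measurable_indic.
apply: cvg_near_cst.
have [p0|p0] := eqVneq (p w) 0.
  apply: nearW => m; rewrite -/(p w) p0 /h big1.
    by rewrite /num_roots fsbig1// => x _; exact: mup0.
  move=> j _; rewrite big1// => z _; rewrite indicE memNset// => -[].
  by rewrite p0 eqxx.
have [N _ HN] := near_num_roots p0 (size_poly _ _).
exists N => // m Nm; rewrite -/(p w) (HN m.+1 (leqW Nm)) natr_sum.
apply: eq_bigr => j _; rewrite natr_sum; apply: eq_bigr => z _.
rewrite indicE; congr (_ (nat_of_bool _)); apply/idP/asboolP.
  by rewrite inE => -[].
by rewrite inE.
Qed.

(** * Slowly varying tails *)

Section SlowVariation.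
Variables (R : realType) (F : R -> R).
Hypothesis Fmono : forall x y, x <= y -> F y <= F x.
Hypothesis F01 : forall x, 0 <= F x <= 1.
Hypothesis Fpos : \forall t \near +oo, 0 < F t.
Hypothesis Fslow : forall l : R, 0 < l -> F (l * t) / F t @[t --> +oo] --> (1 : R).

Let F_ge0 x : 0 <= F x. Proof. by case/andP: (F01 x). Qed.
Let F_le1 x : F x <= 1. Proof. by case/andP: (F01 x). Qed.

Lemma slow_ratio (l e : R) : 0 < l -> 0 < e ->
  exists x0, 0 < x0 /\ forall x, x0 <= x ->
    [/\ 0 < F x, (1 - e) * F x <= F (l * x) & F (l * x) <= (1 + e) * F x].
Proof.
move=> l0 e0; have [M [Mr HM]] : \forall t \near +oo,
    0 < F t /\ `|1 - F (l * t) / F t| < e.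
  by apply: filterI Fpos _; move/cvgrPdist_lt : (Fslow l0); exact.
exists (Num.max M 0 + 1); split.
  by rewrite ltr_wpDl// le_max lexx orbT.
move=> x Mx; have [|Fx] := HM x.
  by apply: lt_le_trans Mx; rewrite (@le_lt_trans _ _ (Num.max M 0))//
    ?le_max ?lexx// ltrDl.
rewrite distrC ltr_norml => /andP[h1 h2]; split => //.
  by rewrite -ler_pdivlMr//; lra.
by rewrite -ler_pdivrMr//; lra.
Qed.

(** The Potter bound with exponent 1/2: F(x) sqrt x is almost increasing, because
    F(x) <= sqrt 2 F(2 x) for large x, and doubling x multiplies sqrt x by
    sqrt 2. *)
Lemma potter_bound : exists s0, 0 < s0 /\ [/\ 0 < F s0,
  forall x, s0 <= x -> F x <= 2 * F (2 * x)
  & forall x y, s0 <= x -> x <= y ->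
      F x * Num.sqrt x <= 2 * (F y * Num.sqrt y)].
Proof.
pose r : R := Num.sqrt 2.
have r2 : r * r = 2 by rewrite -expr2 sqr_sqrtr.
have r0 : 0 <= r by exact: sqrtr_ge0.
have r1 : 1 < r by nra.
have [s0 [s00 H]] := @slow_ratio 2 (1 - r^-1) ltac:(lra)
  ltac:(by rewrite subr_gt0 invf_lt1//; lra).
have step x : s0 <= x -> F x <= r * F (2 * x).
  move=> /H[_ + _]; rewrite opprB addrC subrK -ler_pdivlMl ?invr_gt0 ?invrK//.
  lra.
exists s0; split => //; split => [|x /step|x y sx xy].
- by have [] := H s0 (lexx _).
- have := F_ge0 (2 * x); nra.
suff P i z w : s0 <= z -> z <= w -> w <= 2 ^+ i * z ->
    F z * Num.sqrt z <= r * (F w * Num.sqrt w).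
  have x0 : 0 < x by exact: lt_le_trans sx.
  have [i iP] : exists i : nat, y <= 2 ^+ i * x.
    exists (Num.truncn (y / x)).+1.
    rewrite -ler_pdivrMr//; apply: le_trans (ltW (truncnS_gt _)) _.
    by rewrite -natrX ler_nat ltnW// ltn_expl.
  apply: le_trans (P i x y sx xy iP) _; rewrite ler_wpM2r//.
    by rewrite mulr_ge0 ?sqrtr_ge0.
  by nra.
elim: i z w => [|i IH] z w sz zw.
  rewrite expr0 mul1r => wz; have -> : w = z by apply/eqP; rewrite eq_le wz.
  by rewrite ler_peMl ?mulr_ge0 ?sqrtr_ge0// ltW.
move=> wz; have z0 : 0 < z by exact: lt_le_trans sz.
have [w2|w2] := leP w (2 * z).
  apply: le_trans (_ : r * F (2 * z) * Num.sqrt z <= _).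
    by rewrite ler_wpM2r ?sqrtr_ge0// step.
  rewrite -mulrA ler_wpM2l// ler_pM ?sqrtr_ge0//; first exact: Fmono.
  by rewrite ler_sqrt//; lra.
apply: le_trans (_ : r * F (2 * z) * Num.sqrt z <= _).
  by rewrite ler_wpM2r ?sqrtr_ge0// step.
have -> : r * F (2 * z) * Num.sqrt z = F (2 * z) * Num.sqrt (2 * z).
  by rewrite sqrtrM// -/r; ring.
apply: IH; [lra|lra|].
by move: wz; rewrite exprSr mulrA.
Qed.

(** Unlike in [potter_bound], the smaller argument may be anything positive: when
    it is not large, F is bounded by 1. *)
Lemma potter_scale : exists y0 C : R, [/\ 0 < y0, 0 < C & forall y u : R,
  y0 <= y -> 0 < u <= 1 -> F (u * y) * Num.sqrt u <= C * F y].
Proof.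
have [s0 [s00 [Fs0 _ P]]] := potter_bound.
exists s0, (2 / F s0); split; rewrite ?divr_gt0// => y u sy /andP[u0 u1].
have y0 : 0 < y by exact: lt_le_trans sy.
have sy0 : 0 < Num.sqrt y by rewrite sqrtr_gt0.
have C2 : 2 <= 2 / F s0 by rewrite ler_peMr// invf_ge1.
rewrite -(ler_pM2r sy0); have [h|h] := leP s0 (u * y).
  apply: le_trans (_ : 2 * (F y * Num.sqrt y) <= _).
    rewrite -mulrA -sqrtrM; last exact: ltW.
    by apply: P => //; rewrite ler_piMl// ltW.
  by rewrite mulrA !ler_wpM2r// sqrtr_ge0.
apply: le_trans (_ : 1 * Num.sqrt s0 <= _).
  rewrite -mulrA -sqrtrM ?(ltW u0)//; apply: ler_pM => //.
  by rewrite ler_wsqrtr// ltW.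
rewrite mul1r -!mulrA mulrCA -ler_pdivrMl; last by rewrite invr_gt0.
by rewrite invrK; exact: P.
Qed.

Lemma sum_inv_sqrt (n : nat) (x : R) : 0 <= x ->
  \sum_(1 <= k < n.+1 | k%:R <= x) (Num.sqrt k%:R)^-1 <=
  2 * Num.sqrt (Num.min n%:R x).
Proof.
move=> x0; elim: n => [|n IH].
  by rewrite big_geq// mulr_ge0// sqrtr_ge0.
rewrite big_mkcond big_nat_recr//= -big_mkcond/=.
apply: le_trans (lerD IH (lexx _)) _.
have [nx|nx] := leP n.+1%:R x; last first.
  by rewrite addr0 ler_wpM2l// ler_wsqrtr// ge_min lexx orbT.
have nx' : n%:R <= x by rewrite (le_trans _ nx)// ler_nat.
rewrite (min_l nx').
set a : R := n%:R; have a0 : 0 <= a by exact: ler0n.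
have -> : n.+1%:R = a + 1 :> R by rewrite -natr1.
have b0 : 0 < Num.sqrt (a + 1) by rewrite sqrtr_gt0; lra.
rewrite -(ler_pM2r b0) mulrDl mulVf ?gt_eqF// -[leRHS]mulrA -expr2 sqr_sqrtr; last by lra.
have := sqr_ge0 (Num.sqrt (a + 1) - Num.sqrt a).
rewrite sqrrB !sqr_sqrtr//; lra.
Qed.

(** Each term with k > rho n is o(F(y)), by slow variation.  For k <= rho n,
    [potter_scale] bounds it by C sqrt(n / k) F(y), and these bounds sum to
    O(sqrt rho) n F(y). *)
Lemma karamata_sum (e : R) : 0 < e ->
  exists y0 : R, 0 < y0 /\ forall (y : R) n, y0 <= y ->
  \sum_(1 <= k < n) (F (k%:R / (4 * n%:R) * y) - F (2 * y)) <=
  e * (n%:R * F y).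
Proof.
move=> e0; have [y1 [C [y10 C0 P]]] := potter_scale.
(* sqrt rho = r is chosen to make the contribution of k <= rho n at most e / 2 *)
pose r := Num.min 1 (e / (8 * C)); pose rho := r ^+ 2.
have r0 : 0 < r by rewrite lt_min ltr01 divr_gt0 ?mulr_gt0.
have rho0 : 0 < rho by rewrite exprn_gt0.
have [y2 [y20 H2]] := @slow_ratio (rho / 4) (e / 4) ltac:(by rewrite divr_gt0)
  ltac:(by rewrite divr_gt0).
have [y3 [y30 H3]] := @slow_ratio 2 (e / 4) ltac:(lra) ltac:(by rewrite divr_gt0).
exists (y1 + y2 + y3); split => [|y n yy]; first lra.
have [Fy _ h2] := H2 y ltac:(lra); have [_ h3 _] := H3 y ltac:(lra).
have y0 : 0 < y by lra.
have [->|n0] := posnP n; first by rewrite big_geq// mul0r mulr0.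
have n0' : 0 < n%:R :> R by rewrite ltr0n.
have sn : 0 < Num.sqrt n%:R :> R by rewrite sqrtr_gt0.
apply: le_trans (_ : \sum_(1 <= k < n) (e / 2 * F y +
    (if k%:R <= rho * n%:R then 2 * C * F y * Num.sqrt n%:R * (Num.sqrt k%:R)^-1
     else 0)) <= _).
  rewrite !big_nat; apply: ler_sum => k /andP[k0 kn].
  have k0' : 0 < k%:R :> R by rewrite ltr0n.
  have sk : 0 < Num.sqrt k%:R :> R by rewrite sqrtr_gt0.
  case: (leP k%:R (rho * n%:R)) => [kr|kr].
    rewrite ler_wpDl ?mulr_ge0//; first lra.
    apply: le_trans (_ : F (k%:R / (4 * n%:R) * y) <= _).
      by rewrite gerDl oppr_le0.
    rewrite ler_pdivlMr//.
    have := P y (k%:R / (4 * n%:R)) ltac:(lra).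
    set u : R := _ / _; have u1 : 0 < u <= 1.
      rewrite divr_gt0 ?mulr_gt0//= ler_pdivrMr ?mulr_gt0//.
      have : k%:R <= n%:R :> R by rewrite ler_nat ltnW.
      lra.
    move=> /(_ u1); rewrite /u sqrtrM ?(ltW k0')// sqrtrV ?mulr_ge0// sqrtrM//.
    have -> : Num.sqrt 4 = 2 :> R.
      by rewrite (_ : 4 = 2 ^+ 2) ?sqrtr_sqr ?ger0_norm//; ring.
    rewrite mulrA ler_pdivrMr ?mulr_gt0//.
    by move=> h; apply: le_trans h _; rewrite le_eqVlt; apply/orP; left; apply/eqP; ring.
  rewrite addr0; apply: le_trans (_ : F (rho / 4 * y) - F (2 * y) <= _).
    rewrite lerD2r; apply: Fmono; rewrite ler_pM2r//.
    rewrite ler_pdivlMr ?mulr_gt0//; lra.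
  lra.
rewrite big_split/= sumr_const_nat -[X in X + _]mulr_natl.
rewrite -big_mkcond/= -mulr_sumr.
have : \sum_(1 <= k < n | k%:R <= rho * n%:R) (Num.sqrt k%:R)^-1 <=
    2 * (r * Num.sqrt n%:R) :> R.
  have := sum_inv_sqrt n.-1 (mulr_ge0 (ltW rho0) (ltW n0')).
  rewrite prednK// => h; apply: le_trans h _; rewrite ler_wpM2l//.
  rewrite -[r]ger0_norm ?(ltW r0)// -sqrtr_sqr -/rho -sqrtrM ?(ltW rho0)//.
  by rewrite ler_wsqrtr// ge_min lexx orbT.
set S := \sum_(_ <= _ < _ | _) _ => hS.
have hn : (n - 1)%:R <= n%:R :> R by rewrite ler_nat leq_subr.
apply: le_trans (_ : n%:R * (e / 2 * F y) +
   2 * C * F y * Num.sqrt n%:R * (2 * (r * Num.sqrt n%:R)) <= _).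
  rewrite lerD// ?ler_wpM2r ?mulr_ge0 ?sqrtr_ge0//; first lra.
  by rewrite ler_wpM2l// !mulr_ge0 ?sqrtr_ge0// ltW.
have -> : 2 * C * F y * Num.sqrt n%:R * (2 * (r * Num.sqrt n%:R)) =
    4 * C * r * (n%:R * F y).
  by rewrite -[in RHS](sqr_sqrtr (ltW n0')); ring.
have : C * r <= e / 8.
  have : r <= e / (8 * C) by rewrite ge_min lexx orbT.
  rewrite ler_pdivlMr ?mulr_gt0//; lra.
move=> Cr; have nF : 0 <= n%:R * F y by rewrite mulr_ge0.
have := ler_wpM2r nF Cr; lra.
Qed.

(** The minimum is k or n - k and all the terms are nonnegative, so the sum is at
    most twice the one of [karamata_sum]. *)
Lemma karamata_sum_min (e : R) : 0 < e ->
  exists y0 : R, 0 < y0 /\ forall (y : R) n, y0 <= y ->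
  \sum_(1 <= k < n) (F ((minn k (n - k))%:R / (4 * n%:R) * y) - F (2 * y)) <=
  e * (n%:R * F y).
Proof.
move=> e0; have [y0 [y00 H]] := @karamata_sum (e / 2) ltac:(by rewrite divr_gt0).
exists y0; split => // y n yy.
have y1 : 0 < y by exact: lt_le_trans yy.
pose g k := F (k%:R / (4 * n%:R) * y) - F (2 * y).
have g0 k : (k <= n)%N -> 0 <= g k.
  move=> kn; rewrite subr_ge0; apply: Fmono; rewrite ler_pM2r//.
  have [n0|n0] := posnP n; first by rewrite n0 mulr0 invr0 mulr0.
  rewrite ler_pdivrMr ?mulr_gt0 ?ltr0n//.
  have : k%:R <= n%:R :> R by rewrite ler_nat.
  have : 0 <= n%:R :> R by []. lra.
apply: le_trans (_ : \sum_(1 <= k < n) (g k + g (n - k)%N) <= _).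
  rewrite !big_nat; apply: ler_sum => k /andP[k0 kn].
  rewrite -/(g (minn k (n - k))); rewrite /minn; case: ifP => _.
    by rewrite lerDl g0// leq_subr.
  by rewrite lerDr g0// ltnW.
rewrite big_split/= [X in _ + X]big_nat_rev/=.
rewrite [X in _ + X](_ : _ = \sum_(1 <= k < n) g k); last first.
  by rewrite !big_nat; apply: eq_bigr => k /andP[k0 kn]; congr g; lia.
have := H y n yy; rewrite -/g; lra.
Qed.
End SlowVariation.

(** * Dyadic levels *)

(** Abel summation against nondecreasing weights: only the boundary term at L can
    be negative. *)
Lemma abel_lower (R : realType) (D pi : nat -> R) L :
  (forall i, 0 <= D i) -> (forall i, pi i <= pi i.+1) ->
  (forall i, 0 <= pi i <= 1) ->
  - D L <= \sum_(i < L) (D i - D i.+1) * pi i.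
Proof.
move=> D0 pim pi01; apply: le_trans (_ : - D L * pi L <= _).
  by rewrite mulNr lerN2 ler_piMr//; case/andP: (pi01 L).
elim: L => [|L IH].
  by rewrite big_ord0 mulNr oppr_le0 mulr_ge0//; case/andP: (pi01 0%N).
rewrite big_ord_recr/=; have := ler_wpM2l (D0 L.+1) (pim L).
rewrite mulrBl; lra.
Qed.

Lemma prod1B_lower (R : realType) (I : Type) (s : seq I) (P : pred I) (x y : I -> R) :
  (forall k, P k -> 0 <= y k /\ y k <= x k <= 1) ->
  \prod_(k <- s | P k) (1 - y k) - \sum_(k <- s | P k) (x k - y k) <=
  \prod_(k <- s | P k) (1 - x k).
Proof.
move=> H; pose Q (a b c : R) := [/\ 0 <= b, a <= 1, b <= a & a - c <= b].
suff [] : Q (\prod_(k <- s | P k) (1 - y k)) (\prod_(k <- s | P k) (1 - x k))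
  (\sum_(k <- s | P k) (x k - y k)) by [].
elim/big_rec3: _ => [|k a b c /H[y0 /andP[yx x1]] [b0 a1 ba abc]].
  by split; rewrite ?subr0.
split; nra.
Qed.

Lemma expr1B_diff (R : realType) (a b : R) n : 0 <= b -> b <= a -> a <= 1 ->
  (1 - b) ^+ n - (1 - a) ^+ n <= n%:R * (a - b) * (1 - b) ^+ n.-1.
Proof.
move=> b0 ba a1; case: n => [|n]; first by rewrite !expr0 subrr !mul0r.
rewrite subrXX [X in X * _](_ : _ = a - b); last by ring.
rewrite [n.+1%:R * _]mulrC -mulrA ler_wpM2l ?subr_ge0//.
rewrite mulr_natl -[X in _ *+ X]card_ord -sumr_const; apply: ler_sum => i _.
rewrite /=; have -> : (1 - b) ^+ n = (1 - b) ^+ (n - i) * (1 - b) ^+ i.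
  by rewrite -exprD subnK// -ltnS.
rewrite ler_wpM2l ?exprn_ge0 ?subr_ge0//; first lra.
by rewrite lerXn2r ?nnegrE; lra.
Qed.

Lemma expr1B_upper (R : realType) (x : R) n : 0 <= x <= 1 ->
  (1 - x) ^+ n * (1 + n%:R * x) <= 1.
Proof.
move=> /andP[x0 x1]; elim: n => [|n IH]; first by rewrite expr0 mul0r addr0 mulr1.
have p0 : 0 <= (1 - x) ^+ n by rewrite exprn_ge0// subr_ge0.
have n0 : 0 <= n%:R :> R by [].
apply: le_trans IH; rewrite exprS [X in X * _]mulrC -mulrA ler_wpM2l//.
by rewrite -natr1; nra.
Qed.

(** Up to the error allowed by the last hypothesis, the sum is at least an upper
    Riemann sum of n (1 - x)^(n-1), each term of which exceeds an increment of
    the primitive - (1 - x)^n by [expr1B_diff]. *)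
Lemma telescope_tail (R : realType) (x pi : nat -> R) (n L : nat) (e : R) :
  (forall i, 0 <= x i <= 1) -> (forall i, x i.+1 <= x i) -> 0 <= e ->
  (forall i, (1 - x i.+1) ^+ n.-1 - e * (n%:R * x i) <= pi i) ->
  1 - n%:R * x L - (1 + n%:R * x 0%N)^-1 - e * (n%:R * x 0%N) ^+ 2 <=
  n%:R * \sum_(i < L) (x i - x i.+1) * pi i.
Proof.
move=> x01 xmono e0 piP.
have x0 i : 0 <= x i by case/andP: (x01 i).
have x1 i : x i <= 1 by case/andP: (x01 i).
have xi0 i : x i <= x 0%N by elim: i => // i; exact: le_trans.
have n0 : 0 <= n%:R :> R by [].
have A : 1 - n%:R * x L <= (1 - x L) ^+ n.
  have := expr1B_diff n (lexx 0) (x0 L) (x1 L).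
  by rewrite subr0 expr1n !expr1n mulr1 subr0; lra.
have B : (1 - x 0%N) ^+ n <= (1 + n%:R * x 0%N)^-1.
  by rewrite -[leRHS]mul1r ler_pdivlMr ?expr1B_upper// ltr_wpDr// mulr_ge0.
apply: le_trans (_ : (1 - x L) ^+ n - (1 - x 0%N) ^+ n -
   e * (n%:R * x 0%N) * (n%:R * (x 0%N - x L)) <= _).
  have h : e * (n%:R * x 0%N) * (n%:R * (x 0%N - x L)) <= e * (n%:R * x 0%N) ^+ 2.
    by rewrite expr2 [leRHS]mulrA ler_wpM2l ?mulr_ge0// ler_wpM2l// gerBl.
  lra.
elim: L {A} => [|L IH].
  by rewrite big_ord0 !subrr !mulr0 subrr.
rewrite big_ord_recr/= [leRHS]mulrDr; apply: le_trans _ (lerD IH (lexx _)).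
have h1 := expr1B_diff n (x0 L.+1) (xmono L) (x1 L).
have h2 : n%:R * ((x L - x L.+1) * ((1 - x L.+1) ^+ n.-1 - e * (n%:R * x 0%N))) <=
   n%:R * ((x L - x L.+1) * pi L).
  rewrite ler_wpM2l// ler_wpM2l ?subr_ge0//; apply: le_trans (piP L).
  by rewrite lerB// ler_wpM2l// ler_wpM2l.
have -> : e * (n%:R * x 0%N) * (n%:R * (x 0%N - x L.+1)) =
  e * (n%:R * x 0%N) * (n%:R * (x 0%N - x L)) +
  e * (n%:R * x 0%N) * (n%:R * (x L - x L.+1)) by ring.
move: h2; rewrite mulrBr mulrBr; lra.
Qed.

Section Levels.
Variables (R : realType) (F : R -> R).
Hypothesis Fmono : forall x y, x <= y -> F y <= F x.
Hypothesis F01 : forall x, 0 <= F x <= 1.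
Hypothesis Fpos : \forall t \near +oo, 0 < F t.
Hypothesis Fslow : forall l : R, 0 < l -> F (l * t) / F t @[t --> +oo] --> (1 : R).
Hypothesis F0 : F t @[t --> +oo] --> (0 : R).

Let F_ge0 x : 0 <= F x. Proof. by case/andP: (F01 x). Qed.
Let F_le1 x : F x <= 1. Proof. by case/andP: (F01 x). Qed.

Lemma tail_small (t e : R) : 0 < t -> 0 < e -> exists L : nat, F (2 ^+ L * t) < e.
Proof.
move=> t0 e0; have [M [Mr HM]] : \forall x \near +oo, `|0 - F x| < e.
  by move/cvgrPdist_lt : F0; exact.
exists (Num.truncn (Num.max M 0 / t)).+1.
rewrite -[X in X < _]ger0_norm// -normrN -[- _]add0r; apply: HM.
rewrite (@le_lt_trans _ _ (Num.max M 0)) ?le_max ?lexx//.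
rewrite -ltr_pdivrMr//; apply: lt_le_trans (truncnS_gt _) _.
by rewrite -natrX ler_nat ltnW// ltn_expl.
Qed.

(** Doubling the argument at most halves F: along T, 2 T, 4 T, ... the quantity
    n F cannot jump over the interval [lam, 2 lam]. *)
Lemma level_exists (s0 T lam : R) :
  0 < s0 -> s0 <= T -> 0 < F T -> (forall x, s0 <= x -> F x <= 2 * F (2 * x)) ->
  0 < lam ->
  exists n0 : nat, forall n, (n0 <= n)%N ->
    exists t, T <= t /\ lam <= n%:R * F t <= 2 * lam.
Proof.
move=> s00 sT FT H lam0; have T0 : 0 < T by exact: lt_le_trans sT.
exists (Num.truncn (lam / F T)).+1 => n nn.
have nlam : lam <= n%:R * F T.
  rewrite -ler_pdivrMr//; apply: le_trans (ltW (truncnS_gt _)) _.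
  by rewrite ler_nat.
have n0 : 0 < n%:R :> R by rewrite ltr0n; apply: leq_trans nn.
have ex : exists i, n%:R * F (2 ^+ i * T) < lam.
  have [L HL] := @tail_small T (lam / n%:R) T0 ltac:(by rewrite divr_gt0).
  by exists L; rewrite mulrC -ltr_pdivlMr.
case: (ex_minnP ex) => -[|i] Hi min.
  by move: Hi; rewrite expr0 mul1r ltNge nlam.
have Ti : T <= 2 ^+ i * T by rewrite ler_peMl ?exprn_ege1 ?ler1n// ltW.
exists (2 ^+ i * T); split => //; apply/andP; split.
  by rewrite leNgt; apply/negP => /min; rewrite ltnn.
apply: le_trans (_ : 2 * (n%:R * F (2 * (2 ^+ i * T))) <= _).
  by rewrite mulrCA ler_wpM2l// H// (le_trans sT).
by rewrite ler_wpM2l// mulrA -exprS ltW.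
Qed.

(** The probability that all the interior coefficients lie below the tent given by
    log|xi_k| <= (min(k, n - k) / 4n) y. *)
Definition bulk (n : nat) (y : R) : R :=
  \prod_(1 <= k < n) (1 - F ((minn k (n - k))%:R / (4 * n%:R) * y)).

Lemma bulk_01 n y : 0 <= bulk n y <= 1.
Proof.
rewrite /bulk; apply: (big_ind (fun z : R => 0 <= z <= 1)).
- by rewrite ler01 lexx.
- move=> a b /andP[a0 a1] /andP[b0 b1]; rewrite mulr_ge0//=.
  by rewrite mulr_ile1.
- by move=> k _; rewrite subr_ge0 F_le1/= gerBl.
Qed.

Lemma bulk_mono n y z : y <= z -> bulk n y <= bulk n z.
Proof.
move=> yz; apply: ler_prod => k _; rewrite subr_ge0 F_le1/=.
by rewrite lerB//; apply: Fmono; rewrite ler_wpM2l.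
Qed.

Variables (G : bool -> R -> R) (c : bool -> R).
Hypothesis Gmono : forall b x y, x <= y -> G b y <= G b x.
Hypothesis G0F : forall b x, 0 <= G b x <= F x.
Hypothesis Gc : forall b, G b t / F t @[t --> +oo] --> c b.
Hypothesis c01 : forall b, 0 <= c b <= 1.

(** The hypothesis n F(t) <= 2 lam and the lower bound on F(t) sqrt t force t to be at
    least of order n^2, so that t / 4n is at least of order n, and exp(t / 4n)
    beats every power of n. *)
Lemma growth (Q lam kappa : R) : 0 < Q -> 0 < lam -> 0 < kappa ->
  exists n0 : nat, forall n t, (n0 <= n)%N -> 0 < t ->
    kappa <= F t * Num.sqrt t -> n%:R * F t <= 2 * lam ->
    Q * n.+1%:R ^+ 2 <= expR (t / (4 * n%:R)).
Proof.
move=> Q0 lam0 k0; pose a := (kappa / (2 * lam)) ^+ 2 / 12.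
have a0 : 0 < a by rewrite divr_gt0// exprn_gt0// divr_gt0// mulr_gt0.
exists (Num.truncn (4 * Q / a ^+ 3)).+1 => n t nn t0 kF nF.
have n0 : 0 < n%:R :> R by rewrite ltr0n; apply: leq_trans nn.
have n1 : 1 <= n%:R :> R by rewrite ler1n -(ltr0n R).
have Qn : 4 * Q <= n%:R * a ^+ 3.
  rewrite -ler_pdivrMr ?exprn_gt0//; apply: le_trans (ltW (truncnS_gt _)) _.
  by rewrite ler_nat.
have st : kappa / (2 * lam) * n%:R <= Num.sqrt t.
  rewrite mulrAC ler_pdivrMr ?mulr_gt0//.
  apply: le_trans (ler_wpM2r (ltW n0) kF) _.
  have := ler_wpM2r (sqrtr_ge0 t) nF; lra.
have tn : 3 * a * n%:R <= t / (4 * n%:R).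
  rewrite ler_pdivlMr ?mulr_gt0//.
  have := st; rewrite -(@ler_pXn2r _ 2) ?nnegrE ?sqrtr_ge0//; last first.
    by rewrite mulr_ge0// divr_ge0// ltW// mulr_gt0.
  rewrite sqr_sqrtr; last exact: ltW.
  apply: le_trans; rewrite le_eqVlt /a; apply/orP; left; apply/eqP.
  by field; rewrite gt_eqF.
(* the exponential is at least the cube of a third of its argument *)
apply: le_trans (_ : (a * n%:R) ^+ 3 <= _).
  have -> : (a * n%:R) ^+ 3 = n%:R * a ^+ 3 * n%:R ^+ 2 by ring.
  apply: le_trans (ler_wpM2r (sqr_ge0 _) Qn); rewrite -natr1.
  have : (n%:R + 1) ^+ 2 <= 4 * n%:R ^+ 2 :> R by nra.
  by move=> /(ler_wpM2l (ltW Q0)); lra.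
apply: le_trans (_ : expR (a * n%:R) ^+ 3 <= _).
  have an0 : 0 <= a * n%:R by rewrite mulr_ge0// ltW.
  have anE : a * n%:R <= expR (a * n%:R).
    by apply: le_trans _ (expR_ge1Dx _); rewrite lerDr.
  by rewrite lerXn2r ?nnegrE ?expR_ge0.
by rewrite -expRM_natl ler_expR; apply: le_trans tn; rewrite -mulr_natl; lra.
Qed.

(** G b is the tail of the coefficients of sign b, and c b the limit of its ratio to F.
    The base level t is chosen with n F(t) of order 1 / e, so that some
    coefficient exceeds it with probability close to 1, and L so large that
    with probability close to 1 none exceeds the last level.  Then
    [telescope_tail] gives a total mass close to 1, of which [abel_lower],
    applied to G b - (c b - e) F, attributes almost the share c b to the
    sign b. *)
Lemma levels_exist (d Q : R) : 0 < d -> 0 < Q ->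
  exists n0 : nat, forall n, (n0 <= n)%N -> exists (t : R) (L : nat),
    [/\ 0 < t, Q * n.+1%:R ^+ 2 <= expR (t / (4 * n%:R)) &
     forall b, c b - d <= n%:R * \sum_(i < L)
       (G b (2 ^+ i * t) - G b (2 ^+ i.+1 * t)) * bulk n (2 ^+ i * t)].
Proof.
move=> d0 Q0; pose e := Num.min 1 (d / 6); pose lam := e^-1.
have e0 : 0 < e by rewrite lt_min ltr01 divr_gt0.
have e1 : e <= 1 by rewrite ge_min lexx.
have ed : 6 * e <= d.
  have : e <= d / 6 by rewrite ge_min lexx orbT.
  lra.
have lam0 : 0 < lam by rewrite invr_gt0.
(* eta (n F(t))^2 <= e as soon as n F(t) <= 2 lam *)
pose eta := e / (4 * lam ^+ 2).
have eta0 : 0 < eta by rewrite divr_gt0// mulr_gt0// exprn_gt0.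
have [s0 [s00 [Fs0 F2 P]]] := potter_bound Fmono F01 Fpos Fslow.
have [y0 [y00 K]] := karamata_sum_min Fmono F01 Fpos Fslow eta0.
have [M [Mr HM]] : \forall t \near +oo, 0 < F t /\
    forall b, `|c b - G b t / F t| < e.
  apply: filterI Fpos _.
  have Gnear b : \forall t \near +oo, `|c b - G b t / F t| < e.
    by move/cvgrPdist_lt : (@Gc b); exact.
  by apply: filterS2 (Gnear true) (Gnear false) => t h1 h2 [].
(* from T on, all the asymptotic estimates hold *)
pose T := s0 + y0 + (Num.max M 0 + 1).
have M0 : 0 <= Num.max M 0 by rewrite le_max lexx orbT.
have TM : M < T.
  by apply: (@le_lt_trans _ _ (Num.max M 0)); [rewrite le_max lexx|rewrite /T; lra].
have FT : 0 < F T by have [] := HM T TM.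
have [n1 H1] := @level_exists s0 T lam s00 ltac:(rewrite /T; lra) FT F2 lam0.
pose kappa := F s0 * Num.sqrt s0 / 2.
have k0 : 0 < kappa by rewrite divr_gt0// mulr_gt0 ?sqrtr_gt0.
have [n2 H2] := growth Q0 lam0 k0.
exists (maxn n1 n2).+1 => n nn.
have n0 : 0 < n%:R :> R by rewrite ltr0n; apply: leq_trans nn.
have [|t [Tt /andP[lam1 lam2]]] := H1 n.
  by rewrite (leq_trans _ nn)// leqW// leq_maxl.
have t0 : 0 < t by move: Tt; rewrite /T; lra.
have [L HL] := @tail_small t (e / n%:R) t0 ltac:(by rewrite divr_gt0).
exists t, L; split => //.
  apply: H2 => //; first by rewrite (leq_trans _ nn)// leqW// leq_maxr.
  rewrite /kappa ler_pdivrMr// [leRHS]mulrC; apply: P => //.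
  by move: Tt; rewrite /T; lra.
pose x i := F (2 ^+ i * t); pose pi i := bulk n (2 ^+ i * t).
have tS i : 2 ^+ i * t <= 2 ^+ i.+1 * t.
  by rewrite ler_pM2r// exprS ler_peMl ?exprn_ge0// ler1n.
have tT i : T <= 2 ^+ i * t.
  by apply: le_trans Tt _; rewrite ler_peMl ?exprn_ege1 ?ler1n// ltW.
have X : 1 - 3 * e <= n%:R * \sum_(i < L) (x i - x i.+1) * pi i.
  apply: le_trans (@telescope_tail R x pi n L eta _ _ (ltW eta0) _).
  - have h1 : n%:R * x L <= e by rewrite mulrC -ler_pdivlMr// ltW.
    have x0E : x 0%N = F t by rewrite /x expr0 mul1r.
    have h2 : (1 + n%:R * x 0%N)^-1 <= e.
      rewrite -[leRHS]invrK lef_pV2 ?posrE ?invr_gt0//; last first.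
        by rewrite ltr_wpDr// mulr_ge0 ?F_ge0.
      by rewrite -/lam x0E; lra.
    have h3 : eta * (n%:R * x 0%N) ^+ 2 <= e.
      rewrite x0E /eta mulrAC ler_pdivrMr ?mulr_gt0 ?exprn_gt0//.
      rewrite ler_wpM2l ?(ltW e0)//.
      have -> : 4 * lam ^+ 2 = (2 * lam) ^+ 2 by ring.
      by rewrite lerXn2r ?nnegrE// mulr_ge0// ltW.
    lra.
  - by move=> i; exact: F01.
  - by move=> i; exact/Fmono/tS.
  - move=> i; have Ti := tT i.
    have yi : y0 <= 2 ^+ i * t by move: Ti; rewrite /T; lra.
    have ti0 : 0 < 2 ^+ i * t by exact: lt_le_trans yi.
    have := K _ n yi; have -> : F (2 * (2 ^+ i * t)) = x i.+1.
      by rewrite /x exprS mulrA.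
    move=> Ki.
    rewrite /pi /bulk.
    have := @prod1B_lower R nat (index_iota 1 n) (fun k => 1 <= k < n)%N
      (fun k => F ((minn k (n - k))%:R / (4 * n%:R) * (2 ^+ i * t)))
      (fun=> x i.+1).
    rewrite -!big_nat prodr_const_nat subn1 => h; apply: le_trans (h _).
      by rewrite lerB.
    move=> k /andP[k1 kn]; split; first exact: F_ge0.
    rewrite F_le1 andbT; apply: Fmono; rewrite exprS -[leRHS]mulrA ler_pM2r//.
    rewrite ler_pdivrMr ?mulr_gt0//.
    have : (minn k (n - k))%:R <= n%:R :> R.
      by rewrite ler_nat (leq_trans (geq_minl _ _))// ltnW.
    lra.
move=> b; have Gx i : 0 <= G b (2 ^+ i * t) - (c b - e) * x i.
  have [Fi Gi] := HM (2 ^+ i * t) (lt_le_trans TM (tT i)).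
  have := Gi b; rewrite ltr_norml => /andP[_ h].
  rewrite subr_ge0 -ler_pdivlMr//; lra.
have pi01 i : 0 <= pi i <= 1 by exact: bulk_01.
have pim i : pi i <= pi i.+1 by exact/bulk_mono/tS.
have /andP[c0 c1] := c01 b.
set S := \sum_(_ < _) _.
have [ce|ce] := leP (c b) e.
  have : 0 <= n%:R * S.
    rewrite mulr_ge0//; apply: sumr_ge0 => i _; rewrite mulr_ge0//.
      by rewrite subr_ge0; exact/Gmono/tS.
    by case/andP: (pi01 i).
  lra.
have := @abel_lower R (fun i => G b (2 ^+ i * t) - (c b - e) * x i) pi L Gx pim pi01.
have -> : \sum_(i < L) (G b (2 ^+ i * t) - (c b - e) * x i -
     (G b (2 ^+ i.+1 * t) - (c b - e) * x i.+1)) * pi i =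
   S - (c b - e) * \sum_(i < L) (x i - x i.+1) * pi i.
  by rewrite mulr_sumr -sumrB; apply: eq_bigr => i _; rewrite /pi; ring.
move=> /(ler_wpM2l (ltW n0)); rewrite mulrBr mulrN mulrBr.
have h1 : n%:R * x L <= e by rewrite mulrC -ler_pdivlMr// ltW.
have h2 : n%:R * G b (2 ^+ L * t) <= n%:R * x L.
  by rewrite ler_wpM2l//; case/andP: (G0F b (2 ^+ L * t)).
have h3 : 0 <= (c b - e) * (n%:R * x L).
  by rewrite mulr_ge0 ?subr_ge0 ?(ltW ce)// mulr_ge0 ?F_ge0.
have h4 : (c b - e) * (1 - 3 * e) <=
    (c b - e) * (n%:R * \sum_(i < L) (x i - x i.+1) * pi i).
  by rewrite ler_wpM2l ?subr_ge0 ?(ltW ce).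
rewrite [n%:R * (_ * x L)]mulrCA [n%:R * ((c b - e) * _)]mulrCA.
by nra.
Qed.
End Levels.

(** * From lower bounds on classes to convergence in distribution *)

Lemma bounded_Lfun1 d (T : measurableType d) (R : realType)
    (P : probability T R) (h : T -> R) (M : R) :
  measurable_fun setT h -> (forall w, `|h w| <= M) -> h \in Lfun P 1.
Proof.
move=> mh hM; apply/Lfun1_integrable; apply: measurable_bounded_integrable => //.
  by rewrite (le_lt_trans (probability_le1 P measurableT))// ltry.
exists M; split; first exact: num_real.
by move=> x Mx w _; exact: le_trans (hM w) (ltW Mx).
Qed.

Lemma expectation_ge_sum d (T : measurableType d) (R : realType)
    (P : probability T R) (I : finType) (E : I -> set T) (u : I -> R)
    (h : T -> R) :
  measurable_fun setT h -> (forall w, 0 <= h w) -> (forall i, 0 <= u i) ->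
  (forall i, measurable (E i)) ->
  (forall i j w, E i w -> E j w -> i = j) ->
  (forall i w, E i w -> h w = u i) ->
  ((\sum_i u i * fine (P (E i)))%:E <= 'E_P[h])%E.
Proof.
move=> mh h0 u0 mE dE hE.
have -> : ((\sum_i u i * fine (P (E i)))%:E =
    \int[P]_w (\sum_i u i * \1_(E i) w)%:E)%E.
  under eq_integral do rewrite -sumEFin.
  rewrite ge0_integral_sum//; last 2 first.
  - move=> i; apply/measurable_EFinP/measurable_funM => //.
  - by move=> i w _; rewrite lee_fin mulr_ge0.
  rewrite -sumEFin; apply: eq_bigr => i _.
  under eq_integral do rewrite EFinM.
  rewrite ge0_integralZl_EFin//; last exact/measurable_EFinP.
  by rewrite integral_indic// setIT EFinM fineK ?fin_num_measure.
rewrite expectation.unlock; apply: ge0_le_integral => //.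
- by move=> w _; rewrite lee_fin; apply: sumr_ge0 => i _; rewrite mulr_ge0.
- apply/measurable_EFinP; apply: measurable_sum => i.
  by apply: measurable_funM.
- exact/measurable_EFinP.
- move=> w _; rewrite lee_fin.
  have [[i Ei]|nE] := pselect (exists i, E i w).
    rewrite (bigD1 i)//= big1 ?addr0.
      by rewrite indicE mem_set// mulr1 (hE _ _ Ei).
    move=> j ji; rewrite indicE memNset ?mulr0// => Ej.
    by move: ji; rewrite (dE _ _ _ Ej Ei) eqxx.
  rewrite big1// => i _; rewrite indicE memNset ?mulr0// => Ei.
  by apply: nE; exists i.
Qed.

Section Mixture.
Variables (R : realType) (Theta : finType) (wt v : Theta -> R).
Hypothesis wt0 : forall th, 0 <= wt th.
Hypothesis wt1 : \sum_th wt th = 1.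

Let nwt (k : nat) : {nonneg R} :=
  if insub k is Some i then NngNum (wt0 (enum_val (i : 'I_#|Theta|))) else 0%:nng.
Let nv (k : nat) : R :=
  if insub k is Some i then v (enum_val (i : 'I_#|Theta|)) else 0.

(** Weighted sums of measures are indexed by natural numbers, hence the enumeration
    of [Theta] in [nwt] and [nv]. *)
Definition mixture : set R -> \bar R :=
  msum (fun k => mscale (nwt k) \d_(nv k)) #|Theta|.

HB.instance Definition _ := Measure.on mixture.

Lemma mixtureE (A : set R) :
  mixture A = (\sum_(th | v th \in A) wt th)%:E.
Proof.
rewrite /mixture /msum -sumEFin [RHS]big_mkcond/=.
rewrite [RHS](reindex _ (onW_bij _ (enum_val_bij Theta)))/=.
apply: eq_bigr => k _; rewrite /mscale/= /nwt /nv valK/= diracE.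
by case: ifP => _; rewrite ?mule1 ?mule0.
Qed.

Let mixtureT : mixture setT = 1%E.
Proof.
by rewrite mixtureE -wt1; congr EFin; apply: eq_bigl => th; rewrite in_setT.
Qed.

HB.instance Definition _ := @Measure_isProbability.Build _ _ R mixture mixtureT.

Definition mixture_prob : probability R R := mixture.

Lemma expectation_mixture (h : R -> R) (M : R) :
  measurable_fun setT h -> (forall x, `|h x| <= M) ->
  ('E_mixture_prob[h] = (\sum_th wt th * h (v th))%:E)%E.
Proof.
move=> mh hM.
have L1 : h \in Lfun mixture_prob 1 by exact: bounded_Lfun1 hM.
have L2 : cst M \in Lfun mixture_prob 1 by exact: Lfun_cst.
have g0 x : 0 <= (h \+ cst M) x.
  by have := hM x; rewrite /= ler_norml => /andP[]; lra.
have mg : measurable_fun setT (h \+ cst M) by exact: measurable_funD.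
have E : ('E_mixture_prob[h \+ cst M] =
    (\sum_th wt th * (h \+ cst M) (v th))%:E)%E.
  rewrite expectation.unlock ge0_integral_measure_sum//; last 2 first.
  - by move=> x _; rewrite lee_fin; exact: g0.
  - exact/measurable_EFinP.
  rewrite -sumEFin [RHS](reindex _ (onW_bij _ (enum_val_bij Theta)))/=.
  apply: eq_bigr => k _; rewrite ge0_integral_mscale//; last 2 first.
  - exact/measurable_EFinP.
  - by move=> x _; rewrite lee_fin; exact: g0.
  rewrite integral_dirac//; last exact/measurable_EFinP.
  by rewrite diracE in_setT mul1e /nwt /nv valK.
have fE := expectation_fin_num L1.
move: E; rewrite expectationD// expectation_cst -(fineK fE) -EFinD => -[E].
congr EFin; apply: (addIr M); rewrite E.
under eq_bigr do rewrite mulrDr.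
by rewrite big_split/= -mulr_suml wt1 mul1r.
Qed.

End Mixture.

Definition id_rv (R : realType) : R -> R := idfun.

HB.instance Definition _ (R : realType) :=
  isMeasurableFun.Build _ _ _ _ (@id_rv R) (@measurable_id _ _ setT).

(** The classes are disjoint and the weights sum to 1, so lower bounds suffice:
    if |f| <= M then f + M is nonnegative, and its expectation is at least the
    one taken on the classes.  The upper bound comes from - f. *)
Lemma cvg_in_distribution_mixture d (T : measurableType d) (R : realType)
    (P : probability T R) (Theta : finType) (wt v : Theta -> R)
    (X : nat -> T -> R) :
  (forall th, 0 <= wt th) -> \sum_th wt th = 1 ->
  (forall n, measurable_fun setT (X n)) ->
  (forall e : R, 0 < e -> \forall n \near \oo,
    exists (I : finType) (E : I -> set T) (cl : I -> Theta),
    [/\ forall i, measurable (E i), forall i j w, E i w -> E j w -> i = j,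
        forall i w, E i w -> X n w = v (cl i)
      & forall th, wt th - e <= \sum_(i | cl i == th) fine (P (E i))]) ->
  exists (d1 : measure_display) (T1 : measurableType d1)
      (P1 : probability T1 R) (Y : {RV P1 >-> R}),
    cvg_in_distribution P X Y /\
    forall m, pmf Y m = \sum_(th | v th == m) wt th.
Proof.
move=> wt0 wt1 mX H.
pose Y : {RV (mixture_prob v wt0 wt1) >-> R} := @id_rv R.
exists _, R, (mixture_prob v wt0 wt1), Y; split; last first.
  move=> m; rewrite /pmf [X in fine X](mixtureE v wt0)/=.
  by apply: eq_bigl => th; apply/idP/eqP; rewrite in_setE.
split => // f cf [M [Mr HM]].
(* a positive bound, even when the given M is negative *)
pose M1 := Num.max M 0 + 1.
have M10 : 0 < M1 by rewrite ltr_wpDl// le_max lexx orbT.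
have fM x : `|f x| <= M1.
  by apply: HM => //; rewrite (@le_lt_trans _ _ (Num.max M 0)) ?le_max ?lexx// ltrDl.
have mf : measurable_fun setT f by exact: continuous_measurable_fun.
have -> : ('E_(mixture_prob v wt0 wt1)[f \o Y] = (\sum_th wt th * f (v th))%:E)%E.
  exact: (expectation_mixture v wt0 wt1 mf fM).
set S := \sum_th _.
have mfX n : measurable_fun setT (f \o X n) by exact: measurableT_comp.
have L1 n : (f \o X n) \in Lfun P 1.
  by apply: (@bounded_Lfun1 _ _ _ _ _ M1) => // w; exact: fM.
have lower n e (g : R -> R) : 0 < e -> continuous g -> (forall x, `|g x| <= M1) ->
    (exists (I : finType) (E : I -> set T) (cl : I -> Theta),
    [/\ forall i, measurable (E i), forall i j w, E i w -> E j w -> i = j,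
        forall i w, E i w -> X n w = v (cl i)
      & forall th, wt th - e <= \sum_(i | cl i == th) fine (P (E i))]) ->
    \sum_th wt th * g (v th) - 2 * M1 * #|Theta|%:R * e <= fine 'E_P[g \o X n]%E.
  move=> e0 cg gM [I [E [cl [mE dE XE wE]]]].
  have mg : measurable_fun setT (g \o X n).
    by apply: measurableT_comp => //; exact: continuous_measurable_fun.
  have Lg : (g \o X n) \in Lfun P 1.
    by apply: (@bounded_Lfun1 _ _ _ _ _ M1) => // w; exact: gM.
  have g0 x : 0 <= g x + M1.
    by have := gM x; rewrite ler_norml => /andP[]; lra.
  have g2 x : g x + M1 <= 2 * M1.
    by have := gM x; rewrite ler_norml => /andP[]; lra.
  have := @expectation_ge_sum _ T R P I E (fun i => g (v (cl i)) + M1)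
    ((g \o X n) \+ cst M1) _ _ _ mE dE _.
  rewrite expectationD//; last exact: Lfun_cst.
  rewrite expectation_cst -(fineK (expectation_fin_num Lg)) -EFinD lee_fin.
  move=> h; have {h} : \sum_i (g (v (cl i)) + M1) * fine (P (E i)) <=
      fine 'E_P[g \o X n]%E + M1.
    apply: h => //.
    - exact: measurable_funD.
    - by move=> w; exact: g0.
    - by move=> i w /XE /= ->.
  rewrite (partition_big cl xpredT)//= => h.
  have : \sum_th (g (v th) + M1) * (wt th - e) <= fine 'E_P[g \o X n]%E + M1.
    apply: le_trans h; apply: ler_sum => th _.
    rewrite (eq_bigr (fun i => (g (v th) + M1) * fine (P (E i)))); last first.
      by move=> i /eqP ->.
    by rewrite -mulr_sumr ler_wpM2l.
  have : \sum_th (g (v th) + M1) * (wt th - e) =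
     \sum_th wt th * g (v th) + M1 - e * \sum_th (g (v th) + M1).
    rewrite -[in X in _ = _ + X - _](mulr1 M1) -wt1 !mulr_sumr -big_split/= -sumrB.
    by apply: eq_bigr => th _; ring.
  have : e * \sum_th (g (v th) + M1) <= e * (2 * M1 * #|Theta|%:R).
    rewrite ler_wpM2l ?(ltW e0)// mulr_natr -sumr_const; apply: ler_sum => th _.
    exact: g2.
  lra.
apply/fine_cvgP; split.
  by apply: nearW => n; exact: expectation_fin_num.
apply/cvgrPdist_le => e e0.
pose e' := e / (2 * M1 * (#|Theta|%:R + 1)).
have th0 : 0 < #|Theta|%:R + 1 :> R by rewrite ltr_wpDl.
have e'0 : 0 < e' by rewrite divr_gt0// !mulr_gt0.
have ee : 2 * M1 * #|Theta|%:R * e' <= e.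
  rewrite /e' mulrCA ler_piMr ?(ltW e0)// ler_pdivrMr ?mulr_gt0// mul1r.
  by rewrite ler_wpM2l ?mulr_ge0 ?(ltW M10)// lerDl.
apply: filterS (H e' e'0) => n Hn /=.
have := lower n e' f e'0 cf fM Hn; rewrite -/S => h1.
have cNf : continuous (fun x => - f x) by move=> x; apply: cvgN; exact: cf.
have h2 := lower n e' (fun x => - f x) e'0 cNf _ Hn.
have {h2} : \sum_th wt th * - f (v th) - 2 * M1 * #|Theta|%:R * e' <=
    - fine 'E_P[f \o X n]%E.
  rewrite -fineN; apply: le_trans (h2 _) _; first by move=> x; rewrite normrN.
  rewrite le_eqVlt; apply/orP; left; apply/eqP; congr fine.
  rewrite (_ : _ \o X n = (-1) \o* (f \o X n)); last first.
    by apply/funext => w /=; rewrite mulrN1.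
  by rewrite expectationZl// EFinN mulN1e.
under eq_bigr do rewrite mulrN.
rewrite sumrN -/S => h2; rewrite ler_norml; apply/andP; split; lra.
Qed.

(** * Coefficient patterns *)

Definition signb (R : realType) (b : bool) (z : R) : R := if b then z else - z.
Definition window (R : realType) (b : bool) (x y : R) : set R :=
  [set z | x < signb b z <= y].
Definition box (R : realType) (y : R) : set R := [set z | `|z| <= y].

Lemma measurable_signb (R : realType) b : measurable_fun setT (@signb R b).
Proof. by case: b; [exact: measurable_id|exact: measurable_funN]. Qed.

Lemma measurable_window (R : realType) b (x y : R) : measurable (window b x y).
Proof.
rewrite (_ : window b x y = signb b @^-1` `]x, y]); last first.
  by apply/seteqP; split => z /=; rewrite in_itv.
by rewrite -[X in measurable X]setTI; exact: measurable_signb.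
Qed.

Lemma measurable_box (R : realType) (y : R) : measurable (box y).
Proof.
rewrite (_ : box y = `[- y, y]%classic) //.
by apply/seteqP; split => z; rewrite /box/= in_itv/= ler_norml.
Qed.

Lemma window_sign (R : realType) b (x y z : R) : 0 <= x -> window b x y z ->
  z = (-1) ^+ (~~ b) * `|z| /\ x < `|z| <= y.
Proof.
move=> x0; rewrite /window/= /signb; case: b => /= /andP[xz zy].
  by rewrite expr0 mul1r gtr0_norm ?xz ?zy// (le_lt_trans x0).
have z0 : z < 0 by rewrite -oppr_gt0 (le_lt_trans x0).
by rewrite expr1 mulN1r ltr0_norm// opprK xz zy.
Qed.

Lemma window_mul_sign (R : realType) b1 b2 (x1 y1 x2 y2 z1 z2 : R) k :
  0 <= x1 -> 0 <= x2 -> window b1 x1 y1 z1 -> window b2 x2 y2 z2 ->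
  ((-1) ^+ k * (z1 * z2) < 0) = odd k (+) (b1 (+) b2).
Proof.
move=> x10 x20 /(window_sign x10)[E1 /andP[z10 _]].
move=> /(window_sign x20)[E2 /andP[z20 _]].
have zz : 0 < `|z1| * `|z2|.
  by rewrite mulr_gt0// ?(le_lt_trans _ z10)// (le_lt_trans _ z20).
rewrite E1 E2 mulrACA -signr_addb (mulrA ((-1) ^+ k)) -signr_odd -signr_addb.
have -> : ~~ b1 (+) ~~ b2 = b1 (+) b2 by case: b1 b2 {E1 E2} => -[].
case: (odd k (+) _) => /=; first by rewrite expr1 mulN1r oppr_lt0.
by rewrite expr0 mul1r ltNge ltW.
Qed.

(** The number of real roots as a function of the parity o of the degree, the parity e
    of the dominating index, and the signs s, s0, s1 of the dominating, first
    and last coefficients ([true] meaning positive): the four summands of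
    [num_roots_dominated], since a product is negative iff the signs differ. *)
Definition root_value (o : bool) (th : bool * (bool * bool * bool)) : nat :=
  let: (e, (s, s0, s1)) := th in
  ((s0 (+) s) + (e (+) (s0 (+) s)) + ((s1 (+) s) + ((o (+) e) (+) (s1 (+) s))))%N.

(** The constraint on the k-th coefficient: the first and the last one have moderate
    size, the logarithm of the j-th one lies between the levels y and 2 y, and
    the other ones are below the tent of [bulk]. *)
Definition coef_pattern (R : realType) (n j : nat) (s s0 s1 : bool) (K y : R)
    (k : nat) : set R :=
  if k == 0%N then window s0 K^-1 K
  else if k == n then window s1 K^-1 K
  else if k == j then window s (expR y) (expR (2 * y))
  else box (expR ((minn k (n - k))%:R / (4 * n%:R) * y)).

Lemma measurable_coef_pattern (R : realType) n j s s0 s1 (K y : R) k :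
  measurable (coef_pattern n j s s0 s1 K y k).
Proof.
rewrite /coef_pattern; case: ifP => _; first exact: measurable_window.
case: ifP => _; first exact: measurable_window.
by case: ifP => _; [exact: measurable_window|exact: measurable_box].
Qed.

Lemma coef_pattern_num_roots (R : realType) (a : nat -> R) n j s s0 s1 (K y : R) :
  (0 < j < n)%N -> 1 <= K ->
  8 * K * n.+1%:R ^+ 2 <= expR (y / (4 * n%:R)) ->
  (forall k, (k < n.+1)%N -> coef_pattern n j s s0 s1 K y k (a k)) ->
  num_roots (\poly_(k < n.+1) a k) = root_value (odd n) (odd j, (s, s0, s1)).
Proof.
move=> jn K1 Kq H; have [j0 ltjn] := andP jn.
have n0 : (0 < n)%N by exact: ltn_trans ltjn.
have n0R : 0 < n%:R :> R by rewrite ltr0n.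
have K0 : 0 < K by exact: lt_le_trans K1.
have Ki : 0 <= K^-1 by rewrite invr_ge0 ltW.
have P0 : window s0 K^-1 K (a 0%N) by have := H 0%N isT.
have Pn : window s1 K^-1 K (a n).
  by have := H n (ltnSn n); rewrite /coef_pattern (gtn_eqF n0) eqxx.
have Pj : window s (expR y) (expR (2 * y)) (a j).
  have := H j (ltnW ltjn); rewrite /coef_pattern (gtn_eqF j0) (ltn_eqF ltjn) eqxx.
  exact.
have [_ /andP[aj _]] := window_sign (expR_ge0 y) Pj.
have [_ /andP[a01 a02]] := window_sign Ki P0.
have [_ /andP[an1 an2]] := window_sign Ki Pn.
have dom : dominated a n j (expR (y / (4 * n%:R))) K.
  split => //.
  - apply: le_trans (ltW aj); rewrite -expRM_natl natrM ler_expR.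
    by rewrite mulrC divfK// gt_eqF// mulr_gt0.
  - move=> k /andP[k0 kn] kj; have := H k (ltnW kn).
    rewrite /coef_pattern (gtn_eqF k0) (ltn_eqF kn) (negPf kj) /box/=.
    by rewrite -expRM_natl mulrAC mulrA.
  - by rewrite (ltW a01) a02 (ltW an1) an2.
rewrite (num_roots_dominated K1 Kq dom) /root_value.
have S0 k := window_mul_sign k Ki (expR_ge0 y) P0 Pj.
have Sn k := window_mul_sign k Ki (expR_ge0 y) Pn Pj.
have := S0 0%N; have := Sn 0%N; rewrite expr0 !mul1r/= => -> ->.
by rewrite S0 Sn oddD.
Qed.

Lemma box_expR_le (R : realType) n k (y z : R) : 0 <= y ->
  box (expR ((minn k (n - k))%:R / (4 * n%:R) * y)) z -> `|z| <= expR y.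
Proof.
move=> y0 /le_trans; apply; rewrite ler_expR ler_piMl//.
have [->|n0] := posnP n; first by rewrite mulr0 invr0 mulr0.
have n0R : 0 < n%:R :> R by rewrite ltr0n.
rewrite ler_pdivrMr ?mulr_gt0// mul1r.
have : (minn k (n - k))%:R <= n%:R :> R.
  by rewrite ler_nat (leq_trans (geq_minr _ _))// leq_subr.
lra.
Qed.

(** The index j is the one of the largest interior coefficient, since the tent stays
    below the level that log|a j| exceeds; the level i is then the one that
    contains log|a j|, and the signs are those of the coefficients. *)
Lemma coef_pattern_inj (R : realType) (a : nat -> R) n (K t : R)
    (j j' i i' : nat) (s s0 s1 s' s0' s1' : bool) :
  (0 < j < n)%N -> (0 < j' < n)%N -> 1 <= K -> 0 < t ->
  (forall k, (k < n.+1)%N -> coef_pattern n j s s0 s1 K (2 ^+ i * t) k (a k)) ->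
  (forall k, (k < n.+1)%N -> coef_pattern n j' s' s0' s1' K (2 ^+ i' * t) k (a k)) ->
  [/\ j = j', i = i' & (s, s0, s1) = (s', s0', s1')].
Proof.
move=> jn jn' K1 t0.
have K0 : 0 < K by exact: lt_le_trans K1.
have Ki : 0 <= K^-1 by rewrite invr_ge0 ltW.
pose pat j i s s0 s1 := forall k, (k < n.+1)%N ->
  coef_pattern n j s s0 s1 K (2 ^+ i * t) k (a k).
have ext (l l' : nat) b b0 b1 : (0 < l < n)%N -> pat l l' b b0 b1 ->
    [/\ window b0 K^-1 K (a 0%N), window b1 K^-1 K (a n),
        window b (expR (2 ^+ l' * t)) (expR (2 ^+ l'.+1 * t)) (a l)
      & forall k, (0 < k < n)%N -> k != l -> `|a k| < `|a l|].
  move=> /andP[l0 ln] H.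
  have n0 : (0 < n)%N by exact: ltn_trans ln.
  have Hl : window b (expR (2 ^+ l' * t)) (expR (2 ^+ l'.+1 * t)) (a l).
    have := H l (ltnW ln); rewrite /coef_pattern (gtn_eqF l0) (ltn_eqF ln) eqxx.
    by rewrite mulrA -exprS.
  split => //; first exact: (H 0%N isT).
    by have := H n (ltnSn n); rewrite /coef_pattern (gtn_eqF n0) eqxx.
  move=> k /andP[k0 kn] kl; have := H k (ltnW kn).
  rewrite /coef_pattern (gtn_eqF k0) (ltn_eqF kn) (negPf kl) => /box_expR_le.
  have [_ /andP[+ _]] := window_sign (expR_ge0 _) Hl.
  by move=> h1 h2; apply: le_lt_trans h1; apply: h2; rewrite mulr_ge0 ?exprn_ge0// ltW.
have sgn b b' (x y x' y' z : R) : 0 <= x -> 0 <= x' -> window b x y z ->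
    window b' x' y' z -> b = b'.
  move=> x0 x0' h h'; have := window_mul_sign 0 x0 x0' h h'.
  by rewrite expr0 mul1r -expr2 ltNge sqr_ge0/=; case: b b' {h h'} => -[].
move=> /(ext _ _ _ _ _ jn)[h0 hn hj hk] /(ext _ _ _ _ _ jn')[h0' hn' hj' hk'].
have jE : j = j'.
  apply/eqP/negPn/negP => jj; have h1 := hk' _ jn jj.
  by have := hk _ jn'; rewrite eq_sym => /(_ jj) h2; have := lt_trans h1 h2; rewrite ltxx.
subst j'; have e0 x : 0 <= expR x :> R by exact: expR_ge0.
rewrite (sgn _ _ _ _ _ _ _ _ _ h0 h0')// (sgn _ _ _ _ _ _ _ _ _ hn hn')//.
rewrite (sgn _ _ _ _ _ _ _ _ _ hj hj')//; split => //.
have [_ /andP[+ +]] := window_sign (e0 _) hj.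
have [_ /andP[+ +]] := window_sign (e0 _) hj'.
move=> h1 h2 h3 h4.
have mono l m : expR (2 ^+ l * t) < expR (2 ^+ m.+1 * t) -> (l <= m)%N.
  by rewrite ltr_expR ltr_pM2r// ltr_eXn2l// ltr1n.
apply/eqP; rewrite eqn_leq; apply/andP; split; apply: mono.
  exact: lt_le_trans h3 h2.
exact: lt_le_trans h1 h4.
Qed.

Lemma cvg_expR_pinfty (R : realType) : expR x @[x --> +oo] --> (+oo : set_system R).
Proof.
apply/cvgryPgt => A; near=> x; apply: (@lt_le_trans _ _ x).
  by near: x; apply: nbhs_pinfty_gt; exact: num_real.
by apply: le_trans (expR_ge1Dx x); rewrite lerDr.
Unshelve. all: by end_near. Qed.

HB.instance Definition _ (R : realType) b :=
  isMeasurableFun.Build _ _ _ _ (@signb R b) (measurable_signb b).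

(** * The law of the coefficients *)

Section Coefficients.
Variables (R : realType) (d : measure_display) (T : measurableType d).
Variables (P : probability T R) (xi : nat -> {RV P >-> R}).

Definition law (A : set R) : R := fine (P (xi 0%N @^-1` A)).
(** The tail of xi_0 or of - xi_0.  Its value at 0 is the probability of a sign, its
    behavior at infinity is the one of the large coefficients of that sign. *)
Definition signed_tail (b : bool) (x : R) : R := law [set z | x < signb b z].
Definition log_tail (t : R) : R := fine (P [set w | t < ln `|xi 0%N w|]).

Let mpre (A : set R) : measurable A -> measurable (xi 0%N @^-1` A).
Proof. exact: measurable_funPTI. Qed.

Lemma law01 A : measurable A -> 0 <= law A <= 1.
Proof.
move=> /mpre mA; rewrite fine_ge0//= -lee_fin fineK ?fin_num_measure//.
exact: probability_le1.
Qed.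

Lemma lawU A B : measurable A -> measurable B -> A `&` B = set0 ->
  law (A `|` B) = law A + law B.
Proof.
move=> mA mB AB; rewrite /law preimage_setU measureU; [|exact: mpre|exact: mpre|].
  by rewrite fineD ?fin_num_measure//; exact: mpre.
by rewrite -preimage_setI AB preimage_set0.
Qed.

Lemma law_le A B : measurable A -> measurable B -> A `<=` B -> law A <= law B.
Proof.
move=> mA mB AB; rewrite fine_le ?fin_num_measure//; try exact: mpre.
by rewrite le_measure ?inE//; [exact: mpre|exact: mpre|exact: preimage_subset].
Qed.

Lemma law_setT : law setT = 1.
Proof. by rewrite /law preimage_setT probability_setT. Qed.

Lemma measurable_signed_tail b (x : R) : measurable [set z | x < signb b z].
Proof.
rewrite (_ : [set z | _] = signb b @^-1` `]x, +oo[); last first.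
  by apply/seteqP; split => z /=; rewrite in_itv/= andbT.
by rewrite -[X in measurable X]setTI; exact: measurable_signb.
Qed.

Lemma signed_tailE b x :
  (signed_tail b x)%:E = ccdf (signb b \o xi 0%N : {RV P >-> R}) x.
Proof.
rewrite /signed_tail /law fineK; last first.
  exact: fin_num_measure (mpre (measurable_signed_tail b x)).
rewrite /ccdf /distribution /pushforward/=; congr (P _).
by apply/seteqP; split => w /=; rewrite in_itv/= andbT.
Qed.

Lemma signed_tail_ge0 b x : 0 <= signed_tail b x.
Proof. by case/andP: (law01 (measurable_signed_tail b x)). Qed.

Lemma signed_tail_mono b x y : x <= y -> signed_tail b y <= signed_tail b x.
Proof.
move=> xy; apply: law_le; try exact: measurable_signed_tail.
by move=> z /=; exact: le_lt_trans.
Qed.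

Lemma signed_tail_cvg0 b : signed_tail b x @[x --> +oo] --> (0 : R).
Proof.
have := cvg_ccdfy0 (signb b \o xi 0%N : {RV P >-> R}).
have -> : ccdf (signb b \o xi 0%N : {RV P >-> R}) = EFin \o signed_tail b.
  by apply/funext => x /=; rewrite signed_tailE.
by move=> /fine_cvgP[].
Qed.

Lemma signed_tail_right b (x : R) : signed_tail b y @[y --> x^'+] --> signed_tail b x.
Proof.
have := @ccdf_right_continuous _ _ _ _ (signb b \o xi 0%N : {RV P >-> R}) x.
have -> : ccdf (signb b \o xi 0%N : {RV P >-> R}) = EFin \o signed_tail b.
  by apply/funext => y /=; rewrite signed_tailE.
by move=> /fine_cvgP[].
Qed.

Lemma law_window b x y : x <= y -> law (window b x y) = signed_tail b x - signed_tail b y.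
Proof.
move=> xy; apply/eqP; rewrite eq_sym subr_eq; apply/eqP.
rewrite -lawU; [|exact: measurable_window|exact: measurable_signed_tail|].
  congr law; apply/seteqP; split => z /=.
    by rewrite /window/=; case: (leP (signb b z) y) => yz xz; [left; rewrite xz|right].
  by rewrite /window/= => -[/andP[]//|]; exact: le_lt_trans.
apply/seteqP; split => z //=; rewrite /window/= => -[/andP[_ h1] h2].
by have := le_lt_trans h1 h2; rewrite ltxx.
Qed.

Lemma signed_tail_disjoint (x y : R) : 0 <= x -> 0 <= y ->
  [set z | x < signb true z] `&` [set z | y < signb false z] = set0.
Proof. by move=> x0 y0; apply/seteqP; split => z //=; rewrite /signb => -[] *; lra. Qed.

Lemma signed_tail_abs x : 0 <= x ->
  signed_tail true x + signed_tail false x = law [set z | x < `|z|].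
Proof.
move=> x0; rewrite -lawU ?signed_tail_disjoint//; try exact: measurable_signed_tail.
congr law; apply/seteqP; split => z; rewrite /signb/= lter_normr.
  by move=> h; apply/orP.
by move/orP.
Qed.

Lemma law_box y : 0 <= y -> law (box y) = 1 - (signed_tail true y + signed_tail false y).
Proof.
move=> y0; rewrite signed_tail_abs//; apply/eqP; rewrite eq_sym subr_eq eq_sym; apply/eqP.
have m : measurable [set z : R | y < `|z|].
  rewrite (_ : [set z | _] = ~` box y).
    by apply: measurableC; exact: measurable_box.
  by apply/seteqP; split => z; rewrite /box/= ltNge => /negP.
rewrite -lawU//; last 2 first.
- exact: measurable_box.
- apply/seteqP; split => z //=; rewrite /box/= => -[h1 h2].
  by have := le_lt_trans h1 h2; rewrite ltxx.
rewrite -law_setT; congr law; apply/seteqP; split => z //= _.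
by rewrite /box/=; case: (leP `|z| y) => _; [left|right].
Qed.

Lemma log_tailE t : 0 <= t ->
  log_tail t = signed_tail true (expR t) + signed_tail false (expR t).
Proof.
move=> t0; rewrite signed_tail_abs ?expR_ge0// /log_tail /law; congr (fine (P _)).
apply/seteqP; split => w /=.
  have [->|x0] := eqVneq (xi 0%N w) 0; first by rewrite normr0 ln0// ltNge t0.
  by rewrite -ltr_expR lnK// posrE normr_gt0.
have [->|x0] := eqVneq (xi 0%N w) 0; first by rewrite normr0 ltNge expR_ge0.
by rewrite -[t < ln _]ltr_expR lnK// posrE normr_gt0.
Qed.

Let mlog_tail t : measurable [set w | t < ln `|xi 0%N w|].
Proof.
have m : measurable_fun setT (fun w => ln `|xi 0%N w|).
  apply: (measurableT_comp (@measurable_ln R)).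
  exact: (measurableT_comp (@normr_measurable R setT)).

rewrite (_ : [set w | _] = (fun w => ln `|xi 0%N w|) @^-1` `]t, +oo[); last first.
  by apply/seteqP; split => z /=; rewrite in_itv/= andbT.
by rewrite -[X in measurable X]setTI; exact: m.
Qed.

Lemma log_tail01 t : 0 <= log_tail t <= 1.
Proof.
rewrite fine_ge0//= -lee_fin fineK ?fin_num_measure//.
exact: probability_le1.
Qed.

Lemma log_tail_mono x y : x <= y -> log_tail y <= log_tail x.
Proof.
move=> xy; rewrite fine_le ?fin_num_measure//.
by rewrite le_measure ?inE// => w /=; exact: le_lt_trans.
Qed.

Lemma signed_tail_le_log_tail b t : signed_tail b (expR t) <= log_tail t.
Proof.
rewrite fine_le ?fin_num_measure//; first exact: mpre (measurable_signed_tail b (expR t)).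
rewrite le_measure ?inE//; first exact: mpre (measurable_signed_tail b (expR t)).
move=> w /= h; have {h} : expR t < `|xi 0%N w|.
  apply: lt_le_trans h _; rewrite /signb.
  by case: b; rewrite ?ler_norm// -normrN ler_norm.
move=> h; rewrite -ltr_expR lnK// posrE.
by rewrite (le_lt_trans (expR_ge0 t)).
Qed.

Lemma log_tail_cvg0 : log_tail t @[t --> +oo] --> (0 : R).
Proof.
have C b : signed_tail b (expR t) @[t --> +oo] --> (0 : R).
  exact: cvg_comp (@cvg_expR_pinfty R) (@signed_tail_cvg0 b).
have CD : signed_tail true (expR t) + signed_tail false (expR t) @[t --> +oo] --> (0 : R).
  by rewrite -[X in _ --> X]addr0; apply: cvgD; exact: C.
apply/cvgrPdist_lt => e e0; move/cvgrPdist_lt : CD => /(_ e e0) h.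
apply: filterS2 h (nbhs_pinfty_ge (num_real 0)) => t.
by move=> /[swap] /log_tailE ->.
Qed.

Lemma signed_tail_split0 : {ae P, forall w, xi 0%N w != 0} ->
  signed_tail true 0 + signed_tail false 0 = 1.
Proof.
move=> ae0; rewrite signed_tail_abs//.
have m0 : measurable [set 0 : R] by exact: measurable_set1.
have l0 : law [set 0] = 0.
  rewrite /law (measure_negligible (mpre m0))//.
  by apply: negligibleS ae0 => w /= ->; rewrite eqxx.
have mC : measurable (~` [set 0 : R]) by exact: measurableC.
have := lawU m0 mC (setICr _); rewrite setUv law_setT l0 add0r => ->.
congr law; apply/seteqP; split => z /=; rewrite normr_gt0; first by move/eqP.
by move=> h; apply/eqP.
Qed.

(** The windows exhaust the half-line of sign b: the tail is right-continuous at 0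
    and vanishes at infinity. *)
Lemma window_tight e : 0 < e -> exists K : R, 1 <= K /\
  forall b, signed_tail b 0 - e <= law (window b K^-1 K).
Proof.
move=> e0; have e2 : 0 < e / 2 by rewrite divr_gt0.
have A b : \forall x \near 0^'+, signed_tail b 0 - signed_tail b x <= e / 2.
  have := (@signed_tail_right b 0); move=> /cvgrPdist_le/(_ _ e2); apply: filterS => x.
  by rewrite ler_norml => /andP[].
have B b : \forall x \near +oo, signed_tail b x <= e / 2.
  have := (@signed_tail_cvg0 b); move=> /cvgrPdist_le/(_ _ e2); apply: filterS => x.
  by rewrite sub0r normrN ler_norml => /andP[].
have [/= r r0 Hr] : \forall x \near 0^'+,
    forall b, signed_tail b 0 - signed_tail b x <= e / 2.
  by apply: filterS2 (A true) (A false) => x h1 h2 [].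
have [M [Mr HM]] : \forall x \near +oo, forall b, signed_tail b x <= e / 2.
  by apply: filterS2 (B true) (B false) => x h1 h2 [].
pose K := 1 + Num.max M 0 + r^-1.
have M0 : 0 <= Num.max M 0 by rewrite le_max lexx orbT.
have ri : 0 < r^-1 by rewrite invr_gt0.
have K1 : 1 <= K by rewrite /K; lra.
have K0 : 0 < K by rewrite /K; lra.
exists K; split => // b; rewrite law_window; last first.
  by apply: (le_trans _ K1); rewrite invf_le1.
have h1 : signed_tail b K <= e / 2.
  apply: HM; apply: (@le_lt_trans _ _ (Num.max M 0)); first by rewrite le_max lexx.
  by rewrite /K; lra.
have h2 : signed_tail b 0 - signed_tail b K^-1 <= e / 2.
  apply: Hr; rewrite ?invr_gt0//= sub0r normrN ger0_norm ?invr_ge0 ?(ltW K0)//.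
  by rewrite -[ltRHS]invrK ltf_pV2 ?posrE// /K; lra.
lra.
Qed.

Lemma iid_prob n (A : nat -> set R) : iid xi -> (forall k, measurable (A k)) ->
  measurable [set w | forall k, (k < n)%N -> A k (xi k w)] /\
  fine (P [set w | forall k, (k < n)%N -> A k (xi k w)]) =
  \prod_(0 <= k < n) law (A k).
Proof.
move=> [ind ident] mA.
pose J : {fset nat} := seq_fset tt (iota 0 n).
have JP k : (k \in J) = (k < n)%N by rewrite seq_fsetE mem_iota.
have -> : [set w | forall k, (k < n)%N -> A k (xi k w)] =
    \bigcap_(k in [set` J]) (xi k @^-1` A k).
  apply/seteqP; split => w /= H k; last by rewrite -JP; exact: H.
  by rewrite /= JP; exact: H.
split.
  apply: fin_bigcap_measurable => [|k _]; first exact: finite_fset.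
  exact: measurable_funPTI.
rewrite ind// (perm_big (iota 0 n)); last first.
  by apply: perm_trans (seq_fset_perm _ _) _; rewrite undup_id ?iota_uniq.
rewrite (eq_bigr (fun k => (law (A k))%:E)); last first.
  move=> k _; rewrite /law fineK ?fin_num_measure//; last exact: mpre.
  exact: (ident k 0%N).
by rewrite prodEFin/= /index_iota subn0.
Qed.

End Coefficients.

(** * The limit law *)

(** By independence the probability is a product; the factor of the index j in [bulk]
    is dropped, which makes the bound the same for all j. *)
Lemma coef_pattern_prob (R : realType) (d : measure_display) (T : measurableType d)
    (P : probability T R) (xi : nat -> {RV P >-> R})
    n j s s0 s1 (K y : R) :
  iid xi -> (0 < j < n)%N -> 0 <= y ->
  law xi (window s0 K^-1 K) * law xi (window s1 K^-1 K) *
    ((signed_tail xi s (expR y) - signed_tail xi s (expR (2 * y))) *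
      bulk (log_tail xi) n y) <=
  fine (P [set w | forall k, (k < n.+1)%N -> coef_pattern n j s s0 s1 K y k (xi k w)]).
Proof.
move=> ii jn y0; have [j0 ltjn] := andP jn.
have n0 : (0 < n)%N by exact: ltn_trans ltjn.
have mp k := measurable_coef_pattern n j s s0 s1 K y k.
have lp0 k : 0 <= law xi (coef_pattern n j s s0 s1 K y k).
  by case/andP: (law01 xi (mp k)).
have [_ ->] := iid_prob n.+1 ii mp.
rewrite big_nat_recr//= big_ltn//.
have -> : coef_pattern n j s s0 s1 K y 0 = window s0 K^-1 K by [].
have -> : coef_pattern n j s s0 s1 K y n = window s1 K^-1 K.
  by rewrite /coef_pattern (gtn_eqF n0) eqxx.
rewrite [leRHS]mulrAC ler_wpM2l//.
  have aP b : 0 <= law xi (window b K^-1 K).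
    by case/andP: (law01 xi (measurable_window b K^-1 K)).
  exact: mulr_ge0.
have jI : j \in index_iota 1 n by rewrite mem_index_iota.
rewrite /bulk (bigD1_seq j)//= ?iota_uniq// [leRHS](bigD1_seq j)//= ?iota_uniq//.
have -> : law xi (coef_pattern n j s s0 s1 K y j) =
    signed_tail xi s (expR y) - signed_tail xi s (expR (2 * y)).
  by rewrite /coef_pattern (gtn_eqF j0) (ltn_eqF ltjn) eqxx law_window// ler_expR; lra.
rewrite ler_wpM2l//; first by rewrite subr_ge0 signed_tail_mono// ler_expR; lra.
apply: le_trans (_ : \prod_(k <- index_iota 1 n | k != j)
    (1 - log_tail xi ((minn k (n - k))%:R / (4 * n%:R) * y)) <= _).
  have tail01 k := log_tail01 xi ((minn k (n - k))%:R / (4 * n%:R) * y).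
  rewrite ler_piMl//; last by rewrite gerBl; case/andP: (tail01 j).
  by apply: prodr_ge0 => k _; rewrite subr_ge0; case/andP: (tail01 k).
rewrite le_eqVlt; apply/orP; left; apply/eqP.
rewrite big_seq_cond [RHS]big_seq_cond; apply: eq_bigr => k.
rewrite mem_index_iota => /andP[/andP[k0 kn] kj].
rewrite /coef_pattern (gtn_eqF k0) (ltn_eqF kn) (negPf kj) law_box ?expR_ge0//.
by rewrite -log_tailE// mulr_ge0// divr_ge0// mulr_ge0.
Qed.

(** Subtracting the errors first would fail when a lower bound becomes negative; the
    nonnegativity of [x] and [y] saves these cases. *)
Lemma mul_lower (R : realType) (x y x0 y0 dx dy : R) :
  0 <= x -> 0 <= y -> 0 <= x0 <= 1 -> 0 <= y0 <= 1 -> 0 <= dx -> 0 <= dy ->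
  x0 - dx <= x -> y0 - dy <= y -> x0 * y0 - (dx + dy) <= x * y.
Proof.
move=> xp yp /andP[x00 x01] /andP[y00 y01] dx0 dy0 hx hy.
have xy : 0 <= x * y by exact: mulr_ge0.
have [h|/ltW h] := leP x0 dx; first nra.
have [h'|/ltW h'] := leP y0 dy; first nra.
have : (x0 - dx) * (y0 - dy) <= x * y by rewrite ler_pM ?subr_ge0.
nra.
Qed.

Lemma parity_count (m : nat) (e : bool) :
  (m <= (2 * \sum_(j < m) (odd j.+1 == e)).+1)%N.
Proof.
have [S1 S2] : (\sum_(j < m) (odd j.+1 == true) =
      \sum_(j < m) (odd j.+1 == false) + odd m)%N /\
    (\sum_(j < m) (odd j.+1 == true) + \sum_(j < m) (odd j.+1 == false) = m)%N.
  elim: m => [|m [IH1 IH2]]; first by rewrite !big_ord0.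
  by rewrite !big_ord_recr/= -/(odd m) in IH1 IH2 *; case: (odd m) IH1 => /= IH1; lia.
by case: e; lia.
Qed.

Lemma sum_pair3 (R : realType) (A B C : finType) (pA : pred A) (c0 : C) (f : B -> R) :
  \sum_(x : A * B * C | pA x.1.1 && (x.2 == c0)) f x.1.2 =
  (\sum_(a : A) pA a)%N%:R * \sum_b f b.
Proof.
rewrite -(pair_big (fun ab : A * B => pA ab.1) (pred1 c0) (fun ab _ => f ab.2))/=.
under eq_bigr do rewrite big_pred1_eq.
rewrite (eq_bigl (fun ab : A * B => pA ab.1 && true)); last by move=> ab; rewrite andbT.
rewrite -(pair_big pA xpredT (fun _ b => f b))/= sumr_const.
rewrite mulr_natl; congr (_ *+ _); rewrite -sum1_card big_mkcond.
by apply: eq_bigr => a _; rewrite unfold_in; case: (pA a).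
Qed.

(** The limit probability of the class (e, (s, s0, s1)); [root_value] explains the
    components. *)
Definition weight (R : realType) (c p : R)
    (th : bool * (bool * bool * bool)) : R :=
  let: (e, (s, s0, s1)) := th in
  2^-1 * (bernoulli_pmf c s * (bernoulli_pmf p s0 * bernoulli_pmf p s1)).

Lemma sum_bool4 (R : realType) (F : bool * (bool * bool * bool) -> R)
    (Q : pred (bool * (bool * bool * bool))) :
  \sum_(th | Q th) F th =
  \sum_(e : bool) \sum_(s : bool) \sum_(s0 : bool) \sum_(s1 : bool)
    (if Q (e, (s, s0, s1)) then F (e, (s, s0, s1)) else 0).
Proof.
rewrite big_mkcond; set G := fun th => if Q th then F th else 0.
rewrite (eq_bigr (fun th => G (th.1, th.2))); last by case.
rewrite -(pair_bigA _ (fun e u => G (e, u)))/=; apply: eq_bigr => e _.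
rewrite (eq_bigr (fun u => G (e, (u.1, u.2)))); last by case.
rewrite -(pair_bigA _ (fun v s1 => G (e, (v, s1))))/=.
rewrite (eq_bigr (fun v => \sum_(s1 : bool) G (e, (v.1, v.2, s1)))); last by case.
by rewrite -(pair_bigA _ (fun s s0 => \sum_(s1 : bool) G (e, (s, s0, s1)))).
Qed.

Section Limit.
Variables (R : realType) (d : measure_display) (T : measurableType d).
Variables (P : probability T R) (xi : nat -> {RV P >-> R}) (c p : R).
Hypothesis xi_iid : iid xi.
Hypothesis xi_tail : slowly_varying
  (fun t : R => fine (P [set w | t < ln `|xi 0%N w|])).
Hypothesis xi_c :
  fine (P [set w | t < xi 0%N w]) / fine (P [set w | t < `|xi 0%N w|])
    @[t --> +oo] --> c.
Hypothesis xi_neq0 : {ae P, forall w, xi 0%N w != 0}.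
Hypothesis pE : p = fine (P [set w | 0 < xi 0%N w]).

Lemma signed_tail_at0 b : signed_tail xi b 0 = bernoulli_pmf p b.
Proof.
have h : signed_tail xi true 0 = p by rewrite pE.
by case: b => //=; rewrite -(signed_tail_split0 xi_neq0) h addrC addKr.
Qed.

Lemma bernoulli_pmf01 (q : R) b : 0 <= q <= 1 -> 0 <= bernoulli_pmf q b <= 1.
Proof. by case: b => //= /andP[q0 q1]; rewrite subr_ge0 q1 gerBl. Qed.

Lemma positive_prob01 : 0 <= p <= 1.
Proof.
have -> : p = signed_tail xi true 0 by rewrite signed_tail_at0.
exact: law01 (measurable_signed_tail true 0).
Qed.

Lemma signed_tail_ratio b :
  signed_tail xi b (expR t) / log_tail xi t @[t --> +oo] --> bernoulli_pmf c b.
Proof.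
have [_ tpos _] := xi_tail.
have C : signed_tail xi true (expR t) / log_tail xi t @[t --> +oo] --> c.
  have cE : fine (P [set w | expR t < xi 0%N w]) /
      fine (P [set w | expR t < `|xi 0%N w|]) @[t --> +oo] --> c.
    exact: cvg_comp (@cvg_expR_pinfty R) xi_c.
  apply/cvgrPdist_lt => e e0; move/cvgrPdist_lt : cE => /(_ e e0) h.
  apply: filterS2 h (nbhs_pinfty_ge (num_real 0)) => t /= + t0.
  by rewrite log_tailE// signed_tail_abs// expR_ge0.
case: b => //=; apply/cvgrPdist_lt => e e0.
move/cvgrPdist_lt : C => /(_ e e0) h.
apply: filterS3 h (nbhs_pinfty_ge (num_real 0)) tpos => t h t0 Ft.
have -> : signed_tail xi false (expR t) = log_tail xi t - signed_tail xi true (expR t).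
  by rewrite log_tailE// addrC addKr.
rewrite mulrBl divff ?gt_eqF//; set r := _ / _ in h *.
have -> : 1 - c - (1 - r) = - (c - r) by ring.
by rewrite normrN.
Qed.

Lemma tail_balance01 : 0 <= c <= 1.
Proof.
have r01 t : 0 <= signed_tail xi true (expR t) / log_tail xi t <= 1.
  have [F0 _] := andP (log_tail01 xi t).
  rewrite divr_ge0 ?signed_tail_ge0//=.
  have := signed_tail_le_log_tail xi true t.
  move: F0; rewrite le_eqVlt => /orP[/eqP <-|F0 h].
    by rewrite invr0 mulr0.
  by rewrite ler_pdivrMr// mul1r.
have C := @signed_tail_ratio true; rewrite [bernoulli_pmf _ _]/= in C.
apply/andP; split.
  rewrite -(cvg_lim _ C)//; apply: limr_ge; first by apply/cvg_ex; exists c.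
  by apply: nearW => t; case/andP: (r01 t).
rewrite -(cvg_lim _ C)//; apply: limr_le; first by apply/cvg_ex; exists c.
by apply: nearW => t; case/andP: (r01 t).
Qed.

Lemma weight_ge0 th : 0 <= weight c p th.
Proof.
case: th => e [[s s0] s1] /=.
have [h1 _] := andP (bernoulli_pmf01 s tail_balance01).
have [h2 _] := andP (bernoulli_pmf01 s0 positive_prob01).
by have [h3 _] := andP (bernoulli_pmf01 s1 positive_prob01); rewrite !mulr_ge0.
Qed.

Lemma weight_sum : \sum_th weight c p th = 1.
Proof. by rewrite sum_bool4 !big_bool/= /bernoulli_pmf; field. Qed.

(** For each class, the probabilities of the patterns are summed over the about
    n / 2 indices j of the given parity and over the levels; [levels_exist] and
    [window_tight] estimate the factors. *)
Lemma patterns_frequent (e : R) : 0 < e -> \forall N \near \oo,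
  exists (I : finType) (E : I -> set T) (cl : I -> bool * (bool * bool * bool)),
  [/\ forall i, measurable (E i), forall i j w, E i w -> E j w -> i = j,
      forall i w, E i w ->
        num_roots (\poly_(k < N.+1) xi k w) = root_value (odd N) (cl i)
    & forall th, weight c p th - e <= \sum_(i | cl i == th) fine (P (E i))].
Proof.
move=> e0; have [_ tpos tslow] := xi_tail.
(* each of the four factors of the weight is lost up to dl *)
pose dl := e / 4; have dl0 : 0 < dl by rewrite divr_gt0.
have [K [K1 HK]] := window_tight xi dl0.
have K0 : 0 < K by exact: lt_le_trans K1.
have pc01 b : 0 <= bernoulli_pmf c b <= 1 by exact/bernoulli_pmf01/tail_balance01.
have pp01 b : 0 <= bernoulli_pmf p b <= 1 by exact/bernoulli_pmf01/positive_prob01.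
have Gmono b x y : x <= y -> signed_tail xi b (expR y) <= signed_tail xi b (expR x).
  by move=> xy; apply: signed_tail_mono; rewrite ler_expR.
have G0F b x : 0 <= signed_tail xi b (expR x) <= log_tail xi x.
  by rewrite signed_tail_ge0 signed_tail_le_log_tail.
have [n0 H] := @levels_exist R (log_tail xi) (@log_tail_mono _ _ _ _ xi)
  (log_tail01 xi) tpos tslow (@log_tail_cvg0 _ _ _ _ xi)
  (fun b x => signed_tail xi b (expR x)) (bernoulli_pmf c)
  Gmono G0F (@signed_tail_ratio) pc01
  dl (8 * K) dl0 ltac:(by rewrite mulr_gt0).
exists (maxn n0 (maxn 2 (Num.truncn dl^-1).+1)) => // N /= NN.
have [|t [L [t0 tq W]]] := H N; first by rewrite (leq_trans _ NN)// leq_maxl.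
have N2 : (1 < N)%N.
  by rewrite (leq_trans _ NN)// leq_max (leq_maxl 2) orbT.
have Nd : N%:R^-1 <= dl.
  rewrite -[leRHS]invrK lef_pV2 ?posrE ?invr_gt0 ?ltr0n ?(ltnW N2)//.
  apply: le_trans (ltW (truncnS_gt _)) _; rewrite ler_nat.
  by rewrite (leq_trans _ NN)// leq_max (leq_maxr 2) orbT.
have NR : 0 < N%:R :> R by rewrite ltr0n ltnW.
(* x.1.1 encodes the index j = x.1.1 + 1, which avoids both ends *)
pose I : finType := ('I_N.-1 * 'I_L * (bool * bool * bool))%type.
pose E (x : I) : set T := [set w | forall k, (k < N.+1)%N ->
  coef_pattern N x.1.1.+1 x.2.1.1 x.2.1.2 x.2.2 K (2 ^+ x.1.2 * t) k (xi k w)].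
pose cl (x : I) := (odd x.1.1.+1, x.2).
have jN (j : 'I_N.-1) : (0 < j.+1 < N)%N.
  by rewrite /= -ltn_predRL.
exists I, E, cl; split.
- move=> x; apply: (iid_prob _ _ _).1 => // k; exact: measurable_coef_pattern.
- move=> [[j i] [[s s0] s1]] [[j' i'] [[s' s0'] s1']] w /= h h'.
  have [[/val_inj jj] /val_inj ii [-> -> ->]] :=
    coef_pattern_inj (jN j) (jN j') K1 t0 h h'.
  by move: jj ii => /= -> ->.
- move=> [[j i] [[s s0] s1]] w /= h.
  apply: (coef_pattern_num_roots (jN j) K1 _ h).
  apply: le_trans tq _; rewrite ler_expR ler_pM2r; last by rewrite invr_gt0 mulr_gt0.
  by rewrite ler_peMl ?exprn_ege1 ?ler1n// ltW.
- move=> [b [[s s0] s1]].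
  pose D (i : 'I_L) := (signed_tail xi s (expR (2 ^+ i * t)) -
    signed_tail xi s (expR (2 ^+ i.+1 * t))) * bulk (log_tail xi) N (2 ^+ i * t).
  pose a0 := law xi (window s0 K^-1 K); pose a1 := law xi (window s1 K^-1 K).
  pose cnt : R := (\sum_(j < N.-1) (odd j.+1 == b))%N%:R.
  apply: le_trans (_ : cnt * \sum_i a0 * a1 * D i <= _); last first.
    rewrite -(sum_pair3 (fun j : 'I_N.-1 => odd j.+1 == b) (s, s0, s1)
      (fun i => a0 * a1 * D i)).
    rewrite [leRHS](eq_bigl (fun x : I =>
      (odd x.1.1.+1 == b) && (x.2 == (s, s0, s1)))); last first.
      by move=> x; rewrite /cl xpair_eqE.
    apply: ler_sum => -[[j i] [[s' s0'] s1']] /= /andP[_ /eqP[-> -> ->]].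
    have ti : 0 <= 2 ^+ i * t by rewrite mulr_ge0 ?exprn_ge0// ltW.
    have := @coef_pattern_prob _ _ _ _ xi N j.+1 s s0 s1 K _ xi_iid (jN j) ti.
    by have -> : 2 * (2 ^+ i * t) = 2 ^+ i.+1 * t; first by rewrite exprS mulrA.
  have aP b' : 0 <= law xi (window b' K^-1 K).
    by case/andP: (law01 xi (measurable_window b' K^-1 K)).
  have hp b' : bernoulli_pmf p b' - dl <= law xi (window b' K^-1 K).
    by rewrite -signed_tail_at0.
  have D0 : 0 <= \sum_i D i.
    apply: sumr_ge0 => i _; rewrite mulr_ge0//.
      rewrite subr_ge0; apply: Gmono.
      by rewrite ler_pM2r// exprS ler_peMl ?exprn_ge0// ler1n.
    by case/andP: (bulk_01 (log_tail01 xi) N (2 ^+ i * t)).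
  have hD : bernoulli_pmf c s - dl <= N%:R * \sum_i D i by exact: W.
  have hc : 2^-1 - dl <= cnt / N%:R.
    rewrite ler_pdivlMr//; have := parity_count N.-1 b.
    rewrite -(ler_nat R) -natr1 natrM -/cnt.
    have -> : (N.-1)%:R = N%:R - 1 :> R by rewrite -subn1 natrB// ltnW.
    have : 1 <= dl * N%:R by rewrite -ler_pdivrMr// mul1r.
    lra.
  have -> : cnt * \sum_i a0 * a1 * D i =
     cnt / N%:R * (N%:R * (\sum_i D i) * (a0 * a1)).
    by rewrite -mulr_sumr; field; rewrite gt_eqF.
  have h1 := mul_lower (aP s0) (aP s1) (pp01 s0) (pp01 s1)
    (ltW dl0) (ltW dl0) (hp s0) (hp s1).
  have P01 : 0 <= bernoulli_pmf p s0 * bernoulli_pmf p s1 <= 1.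
    have [? ?] := andP (pp01 s0); have [? ?] := andP (pp01 s1).
    by rewrite mulr_ge0//= mulr_ile1.
  have ND0 : 0 <= N%:R * \sum_i D i by rewrite mulr_ge0.
  have dl2 : 0 <= dl + dl by rewrite addr_ge0// ltW.
  have h2 := mul_lower ND0 (mulr_ge0 (aP s0) (aP s1)) (pc01 s) P01
    (ltW dl0) dl2 hD h1.
  have Q01 : 0 <= bernoulli_pmf c s * (bernoulli_pmf p s0 * bernoulli_pmf p s1) <= 1.
    have [? ?] := andP (pc01 s); have [? ?] := andP P01.
    by rewrite mulr_ge0//= mulr_ile1.
  have dl3 : 0 <= dl + (dl + dl) by rewrite addr_ge0// ltW.
  have half01 : 0 <= (2^-1 : R) <= 1 by lra.
  have cN0 : 0 <= cnt / N%:R by rewrite divr_ge0.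
  have h3 := mul_lower cN0 (mulr_ge0 ND0 (mulr_ge0 (aP s0) (aP s1)))
    half01 Q01 (ltW dl0) dl3 hc h2.
  apply: le_trans h3; rewrite /weight lerB// /dl; lra.
Qed.

Lemma num_roots_limit (o : bool) (m : nat -> nat) :
  (forall n, odd (m n) = o) -> (forall n, (n <= m n)%N) ->
  exists (d1 : measure_display) (T1 : measurableType d1)
      (P1 : probability T1 R) (Y : {RV P1 >-> R}),
    cvg_in_distribution P
      (fun n w => (num_roots (random_poly xi (m n) w))%:R) Y /\
    forall k : nat, pmf Y k%:R = \sum_(th | root_value o th == k) weight c p th.
Proof.
move=> mo mn; have [||d1 [T1 [P1 [Y [cvgY pmfY]]]]] :=
  @cvg_in_distribution_mixture _ _ _ P _ (weight c p)
    (fun th => (root_value o th)%:R) (fun n w => (num_roots (random_poly xi (m n) w))%:R)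
    weight_ge0 weight_sum; last first.
- exists d1, T1, P1, Y; split => // k; rewrite pmfY; apply: eq_bigl => th.
  exact: eqr_nat.
- move=> e e0; have [N _ HN] := patterns_frequent e0.
  exists N => // n /= Nn.
  have [I [E [cl [mE dE rE wE]]]] := HN (m n) (leq_trans Nn (mn n)).
  exists I, E, cl; split => // i w Ew.
  by rewrite /random_poly (rE _ _ Ew) mo.
- move=> n; apply: measurable_num_roots => k; exact: measurable_funP.
Qed.

End Limit.

Theorem theorem1p14 (R : realType) (d : measure_display)
    (T : measurableType d) (P : probability T R)
    (xi : nat -> {RV P >-> R}) (c p : R)
    (xi_iid : iid xi)
    (xi_nondeg : nondegenerate_rv (xi 0%N))
    (xi_tail : slowly_varying
       (fun t : R => fine (P [set w | t < ln `|xi 0%N w|])))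
    (xi_c : fine (P [set w | t < xi 0%N w]) / fine (P [set w | t < `|xi 0%N w|])
              @[t --> +oo] --> c)
    (xi_neq0 : {ae P, forall w, xi 0%N w != 0})
    (pE : p = fine (P [set w | 0 < xi 0%N w])) :
  let N (n : nat) (w : T) : R := (num_roots (random_poly xi n w))%:R in
  (exists (d1 : measure_display) (T1 : measurableType d1)
      (P1 : probability T1 R) (Nplus : {RV P1 >-> R}),
    [/\ cvg_in_distribution P (fun n => N (2 * n)%N) Nplus,
        pmf Nplus 0 = 2^-1 * (c * p ^+ 2 + (1 - c) * (1 - p) ^+ 2),
        pmf Nplus 2 = 2^-1 + p * (1 - p)
      & pmf Nplus 4 = 2^-1 * (c * (1 - p) ^+ 2 + (1 - c) * p ^+ 2)]) /\
  (exists (d2 : measure_display) (T2 : measurableType d2)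
      (P2 : probability T2 R) (Nminus : {RV P2 >-> R}),
    [/\ cvg_in_distribution P (fun n => N (2 * n + 1)%N) Nminus,
        pmf Nminus 1 = 1 - p - c + 2 * p * c
      & pmf Nminus 3 = p + c - 2 * p * c]).
Proof.
move=> N; split.
- have [||d1 [T1 [P1 [Y [cvgY pmfY]]]]] := @num_roots_limit _ _ _ _ _ _ _
    xi_iid xi_tail xi_c xi_neq0 pE false (fun n => (2 * n)%N).
  + by move=> n; rewrite oddM.
  + by move=> n; rewrite leq_pmull.
  exists d1, T1, P1, Y; split => //.
  + by have := pmfY 0%N; rewrite sum_bool4 !big_bool/= /bernoulli_pmf => ->; field.
  + by have := pmfY 2%N; rewrite sum_bool4 !big_bool/= /bernoulli_pmf => ->; field.
  + by have := pmfY 4%N; rewrite sum_bool4 !big_bool/= /bernoulli_pmf => ->; field.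
- have [||d1 [T1 [P1 [Y [cvgY pmfY]]]]] := @num_roots_limit _ _ _ _ _ _ _
    xi_iid xi_tail xi_c xi_neq0 pE true (fun n => (2 * n + 1)%N).
  + by move=> n; rewrite oddD oddM.
  + by move=> n; rewrite addn1 ltnW// ltnS leq_pmull.
  exists d1, T1, P1, Y; split => //.
  + by have := pmfY 1%N; rewrite sum_bool4 !big_bool/= /bernoulli_pmf => ->; field.
  + by have := pmfY 3%N; rewrite sum_bool4 !big_bool/= /bernoulli_pmf => ->; field.
Qed.
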